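(* Let $(R,\mathfrak m)$ be a commutative Noetherian local ring of dimension $d$ with a normalized dualizing complex $I$, and let $E=E_R(R/\mathfrak m)$. Let $X\in D(R)$ satisfy $\mathrm{supp}(\sigma_{\leqq -1}X)\subseteq\{\mathfrak m\}$. Then there is an isomorphism in $D(R)$ $$\sigma_{>0}(X^{\vee})\;\cong\;\sigma_{>d}(X^{\dagger})[d],$$ where $X^{\vee}=\mathrm{RHom}_R(X,E)$ and $X^{\dagger}=\mathrm{RHom}_R(X,I)$.
   Context: $D(R)$ is the full (unbounded) derived category of $R$-modules, with cohomological notation and shift functor $[1]$. The dualizing complex $I$ is normalized so that it has the form $0\to I^0\to I^1\to\cdots\to I^d\to 0$ with $I^i=\bigoplus_{\dim R/\mathfrak p=d-i}E_R(R/\mathfrak p)$, where $E_R(-)$ denotes injective hull. The small support of $X$ is $\mathrm{supp}(X)=\{\mathfrak{p}\in\mathrm{Spec}(R) : X\otimes^{\mathrm L}_R\kappa(\mathfrak{p})\neq 0\}$ with $\kappa(\mathfrak p)=R_{\mathfrak p}/\mathfrak pR_{\mathfrak p}$; the condition $\mathrm{supp}(\sigma_{\leqq -1}X)\subseteq\{\mathfrak m\}$ is equivalent to $\mathrm{Supp}\,H^i(X)\subseteq\{\mathfrak m\}$ for all $i\leqq -1$. Truncations: $\sigma_{>n}X=(\cdots\to 0\to\mathrm{Im}\,d^n\to X^{n+1}\to X^{n+2}\to\cdots)$ and $\sigma_{\leqq n}X=(\cdots\to X^{n-2}\to X^{n-1}\to\mathrm{Ker}\,d^n\to 0\to\cdots)$.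 *)

(* Defs.v *)
From HB Require Import structures.
From mathcomp Require Import all_boot all_order all_algebra.
From mathcomp Require Import generic_quotient ring_quotient.
From mathcomp Require Import boolp.
From mathcomp Require Import zify ring.

Set Implicit Arguments.
Unset Strict Implicit.
Unset Printing Implicit Defensive.

Import Order.TTheory GRing.Theory Num.Theory.
Local Open Scope ring_scope.
Local Open Scope quotient_scope.

Section LinearMaps.
Variable R : pzRingType.
Implicit Types U V : lmodType R.

Definition lin_of U V (f : U -> V) (fL : linear f) : {linear U -> V} :=
  HB.pack f (GRing.isLinear.Build R U V *:%R f fL).

Fact zero_is_linear U V : linear (fun _ : U => 0 : V).
Proof. by move=> a x y; rewrite scaler0 addr0. Qed.
Definition zero_map U V : {linear U -> V} := lin_of (@zero_is_linear U V).

Fact id_is_linear V : linear (fun x : V => x).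
Proof. by []. Qed.
Definition id_map V : {linear V -> V} := lin_of (@id_is_linear V).

(* The identity of F i, transported along i = j when that holds, else 0. *)
Definition eqmap (F : int -> lmodType R) (i j : int) : {linear F i -> F j} :=
  match i =P j with
  | ReflectT e => ecast k {linear F i -> F k} e (id_map (F i))
  | ReflectF _ => zero_map _ _
  end.

Lemma eqmap_id F i x : eqmap F i i x = x.
Proof. by rewrite /eqmap; case: eqP => // e; rewrite eq_axiomK. Qed.

Lemma eqmap_neq F i j x : i <> j -> eqmap F i j x = 0.
Proof. by rewrite /eqmap; case: eqP. Qed.

End LinearMaps.

Section Submodules.
Variables (R : pzRingType) (V : lmodType R) (S : submodClosed V).

Record subm := Subm { subm_val : V; subm_valP : subm_val \in (S : {pred V}) }.

HB.instance Definition _ := [isSub for subm_val].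
HB.instance Definition _ := [Choice of subm by <:].
HB.instance Definition _ := [SubChoice_isSubLmodule of subm by <:].

Definition submod_pred : {pred V} := fun x => x \in (S : {pred V}).
Fact submod_pred_closed : zmod_closed submod_pred.
Proof.
split=> [|x y Sx Sy]; first exact: (rpred0 S).
by apply: (rpredD (S := S)) => //; rewrite -scaleN1r; apply: (rpredZ (s := S)).
Qed.
HB.instance Definition _ := GRing.isZmodClosed.Build V submod_pred
  submod_pred_closed.

Definition quotm := Quotient.quot submod_pred.
HB.instance Definition _ := GRing.Zmodule.on quotm.
HB.instance Definition _ := EqQuotient.on quotm.

Definition cls (x : V) : quotm := \pi_quotm x.

Lemma cls_repr (x : quotm) : cls (repr x) = x.
Proof. exact: reprK. Qed.

Lemma cls_eqP (x y : V) : cls x = cls y <-> x - y \in S.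
Proof.
have E := Quotient.idealrBE submod_pred x y.
split=> [/eqP xy|Sxy]; first by move: xy; rewrite -[_ == _]E.
by apply/eqP; rewrite -[_ == _]E.
Qed.

Lemma clsD x y : cls (x + y) = cls x + cls y.
Proof. exact: raddfD (\pi_(Quotient.quot submod_pred)) x y. Qed.

Definition qscale (a : R) (x : quotm) : quotm := cls (a *: repr x).

Lemma qscale_cls a (x : V) : qscale a (cls x) = cls (a *: x).
Proof.
apply/cls_eqP; rewrite -scalerBr; apply: (rpredZ (s := S)).
by apply/cls_eqP; rewrite cls_repr.
Qed.

Fact qscaleA a b (x : quotm) : qscale a (qscale b x) = qscale (a * b) x.
Proof. by rewrite -(cls_repr x) !qscale_cls scalerA. Qed.
Fact qscale1 : left_id 1 qscale.
Proof. by move=> x; rewrite -(cls_repr x) qscale_cls scale1r. Qed.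
Fact qscaleDr : right_distributive qscale +%R.
Proof.
move=> a x y; rewrite -(cls_repr x) -(cls_repr y) -clsD !qscale_cls -clsD.
by rewrite scalerDr.
Qed.
Fact qscaleDl (x : quotm) : {morph qscale^~ x : a b / a + b}.
Proof. by move=> a b; rewrite -(cls_repr x) !qscale_cls -clsD scalerDl. Qed.

HB.instance Definition _ :=
  GRing.Zmodule_isLmodule.Build R quotm qscaleA qscale1 qscaleDr qscaleDl.

End Submodules.

Section Kernel.
Variables (R : pzRingType) (U V : lmodType R) (f : {linear U -> V}).

Definition ker_pred : {pred U} := fun x => f x == 0.

Fact ker_closed : subsemimod_closed ker_pred.
Proof.
split; first split.
- by rewrite unfold_in linear0.
- by move=> x y; rewrite !unfold_in => /eqP fx /eqP fy; rewrite linearD fx fy addr0.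
- by move=> a x; rewrite !unfold_in => /eqP fx; rewrite linearZ /= fx scaler0.
Qed.
HB.instance Definition _ := GRing.isSubmodClosed.Build R U ker_pred ker_closed.

End Kernel.

Section Tensor.
Variable R : comNzRingType.

Definition bilin (M N L : lmodType R) (B : M -> N -> L) :=
  (forall n, linear (B^~ n)) /\ (forall m, linear (B m)).

Section TensorModule.
Variables M N : lmodType R.

Definition teval (L : lmodType R) (B : M -> N -> L) (s : seq (M * N)) : L :=
  \sum_(t <- s) B t.1 t.2.

(* An element of the tensor product is a formal finite sum of pure tensors; *)
(* two of them are identified when no bilinear map separates them. *)
Definition teq (s t : seq (M * N)) : bool :=
  `[< forall (L : lmodType R) (B : M -> N -> L), bilin B ->
        teval B s = teval B t >].

Fact teq_equiv : equiv_class_of teq.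
Proof.
split=> [s|s t|t s u]; first by apply/asboolP.
  by apply/asboolP/asboolP => h L B /(h L B).
move=> /asboolP h /asboolP k; apply/asboolP => L B bB.
by rewrite (h L B bB) (k L B bB).
Qed.
Canonical teq_equivrel := EquivRelPack teq_equiv.
Canonical teq_encModRel := defaultEncModRel teq.

Definition tensor := {eq_quot teq}.
HB.instance Definition _ : EqQuotient (seq (M * N)) teq tensor :=
  EqQuotient.on tensor.
HB.instance Definition _ := Choice.on tensor.

Definition tcls (s : seq (M * N)) : tensor := \pi_tensor s.

Lemma tcls_repr (x : tensor) : tcls (repr x) = x.
Proof. exact: reprK. Qed.

Lemma tcls_eqP (s t : seq (M * N)) :
  tcls s = tcls t <->
  (forall (L : lmodType R) (B : M -> N -> L), bilin B ->
     teval B s = teval B t).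
Proof.
split=> [/eqmodP /= /asboolP //|h].
by apply/eqmodP/asboolP.
Qed.

Lemma teval_repr (L : lmodType R) (B : M -> N -> L) s :
  bilin B -> teval B (repr (tcls s)) = teval B s.
Proof. by move=> bB; apply: (tcls_eqP _ _).1 => //; rewrite tcls_repr. Qed.

Lemma teval_cat (L : lmodType R) (B : M -> N -> L) s t :
  teval B (s ++ t) = teval B s + teval B t.
Proof. exact: big_cat. Qed.

Definition tscale_seq (a : R) (s : seq (M * N)) :=
  [seq (a *: t.1, t.2) | t <- s].

Lemma teval_scale (L : lmodType R) (B : M -> N -> L) a s :
  bilin B -> teval B (tscale_seq a s) = a *: teval B s.
Proof.
move=> [Bl _]; rewrite /teval big_map scaler_sumr; apply: eq_bigr => t _ /=.
have B0 : B 0 t.2 = 0.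
  by have := Bl t.2 (-1) 0 0; rewrite /= scaler0 addr0 scaleN1r addNr.
by have := Bl t.2 a t.1 0; rewrite /= B0 !addr0.
Qed.

Definition tadd (x y : tensor) : tensor := tcls (repr x ++ repr y).
Definition tzero : tensor := tcls [::].
Definition tscale a (x : tensor) : tensor :=
  tcls (tscale_seq a (repr x)).
Definition topp (x : tensor) : tensor := tscale (-1) x.

Lemma tadd_cls s t : tadd (tcls s) (tcls t) = tcls (s ++ t).
Proof. by apply/tcls_eqP => L B bB; rewrite !teval_cat !teval_repr. Qed.

Lemma tscale_cls a s :
  tscale a (tcls s) = tcls (tscale_seq a s).
Proof. by apply/tcls_eqP => L B bB; rewrite !teval_scale // teval_repr. Qed.

Fact taddA : associative tadd.
Proof.
by move=> x y z; rewrite -(tcls_repr x) -(tcls_repr y) -(tcls_repr z) !tadd_cls catA.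
Qed.
Fact taddC : commutative tadd.
Proof.
move=> x y; rewrite -(tcls_repr x) -(tcls_repr y) !tadd_cls; apply/tcls_eqP => L B _.
by rewrite !teval_cat addrC.
Qed.
Fact tadd0 : left_id tzero tadd.
Proof. by move=> x; rewrite -(tcls_repr x) tadd_cls. Qed.
Fact taddN : left_inverse tzero topp tadd.
Proof.
move=> x; rewrite -(tcls_repr x) /topp tscale_cls tadd_cls; apply/tcls_eqP => L B bB.
by rewrite teval_cat teval_scale // scaleN1r addNr /teval big_nil.
Qed.
HB.instance Definition _ := GRing.isZmodule.Build tensor taddA taddC tadd0 taddN.

Fact tscaleA a b (x : tensor) : tscale a (tscale b x) = tscale (a * b) x.
Proof.
rewrite -(tcls_repr x) !tscale_cls; apply/tcls_eqP => L B bB.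
by rewrite !teval_scale // scalerA.
Qed.
Fact tscale1 : left_id 1 tscale.
Proof.
move=> x; rewrite -(tcls_repr x) tscale_cls; apply/tcls_eqP => L B bB.
by rewrite teval_scale // scale1r.
Qed.
Fact tscaleDr : right_distributive tscale +%R.
Proof.
move=> a x y; rewrite -(tcls_repr x) -(tcls_repr y) [_ + _]tadd_cls !tscale_cls.
rewrite [RHS]tadd_cls; apply/tcls_eqP => L B bB.
by rewrite !(teval_scale, teval_cat) // scalerDr.
Qed.
Fact tscaleDl (x : tensor) : {morph tscale^~ x : a b / a + b}.
Proof.
move=> a b; rewrite -(tcls_repr x) !tscale_cls [RHS]tadd_cls.
apply/tcls_eqP => L B bB.
by rewrite !(teval_scale, teval_cat) // scalerDl.
Qed.
HB.instance Definition _ :=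
  GRing.Zmodule_isLmodule.Build R tensor tscaleA tscale1 tscaleDr tscaleDl.

End TensorModule.

Section TensorMap.
Variables (M M' N : lmodType R) (f : {linear M -> M'}).

Definition tmap_seq (s : seq (M * N)) : seq (M' * N) :=
  [seq (f t.1, t.2) | t <- s].

Definition tmap_fun (x : tensor M N) : tensor M' N :=
  tcls (tmap_seq (repr x)).

Lemma tmap_cls s : tmap_fun (tcls s) = tcls (tmap_seq s).
Proof.
apply/tcls_eqP => L B [Bl Br].
have bBf : bilin (fun x => B (f x)).
  by split=> // n a x y; rewrite linearP; apply: Bl.
have E t : teval B (tmap_seq t) = teval (fun x => B (f x)) t.
  by rewrite /teval big_map.
by rewrite !E teval_repr.
Qed.

Fact tmap_is_linear : linear tmap_fun.
Proof.
move=> a x y; rewrite -(tcls_repr x) -(tcls_repr y).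
rewrite [a *: _]tscale_cls [_ + _]tadd_cls !tmap_cls [a *: _]tscale_cls.
rewrite [RHS]tadd_cls; congr (tcls _).
rewrite /tmap_seq map_cat; congr (_ ++ _).
by rewrite /tscale_seq -!map_comp; apply: eq_map => t /=; rewrite linearZ.
Qed.
Definition tmap : {linear tensor M N -> tensor M' N} := lin_of tmap_is_linear.

Lemma tmap_cls0 : (forall m, f m = 0) -> forall s, tmap_fun (tcls s) = 0.
Proof.
move=> f0 s; rewrite tmap_cls; apply/tcls_eqP => L B [Bl _].
rewrite /teval big_map big_nil big1 // => t _ /=; rewrite f0.
by have := Bl t.2 (-1) 0 0; rewrite /= scaler0 addr0 scaleN1r addNr.
Qed.

End TensorMap.

End Tensor.

Section Localization.
Variables (R : comNzRingType) (p : prime_idealr R).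

Definition denom := {s : R | s \notin (p : {pred R})}.

Fact denom_mul_subproof (s t : denom) : val s * val t \notin (p : {pred R}).
Proof. by rewrite prime_idealrM negb_or (valP s) (valP t). Qed.
Definition denom_mul (s t : denom) : denom :=
  exist (fun x => x \notin (p : {pred R})) _ (denom_mul_subproof s t).

Fact denom1_subproof : 1 \notin (p : {pred R}).
Proof. by rewrite idealr1. Qed.
Definition denom1 : denom :=
  exist (fun x => x \notin (p : {pred R})) _ denom1_subproof.

Lemma val_denom_mul s t : val (denom_mul s t) = val s * val t.
Proof. by []. Qed.
Lemma val_denom1 : val denom1 = 1.
Proof. by []. Qed.
Definition denomE := (val_denom_mul, val_denom1).

Section LocalizedModule.
Variable M : lmodType R.

Definition loc_eq (x y : M * denom) : bool :=
  `[< exists u : denom,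
        val u *: (val y.2 *: x.1) = val u *: (val x.2 *: y.1) >].

Fact loc_eq_equiv : equiv_class_of loc_eq.
Proof.
split=> [x|x y|y x z]; first by apply/asboolP; exists denom1.
  by apply/asboolP/asboolP => -[u h]; exists u.
move=> /asboolP [u h] /asboolP [v k]; apply/asboolP.
exists (denom_mul (denom_mul u v) y.2); rewrite !denomE.
move: h k; rewrite !scalerA => h k.
have -> : val u * val v * val y.2 * val z.2
            = (val v * val z.2) * (val u * val y.2) by ring.
rewrite -scalerA h scalerA.
have -> : val v * val z.2 * (val u * val x.2)
            = (val u * val x.2) * (val v * val z.2) by ring.
rewrite -scalerA k scalerA; congr (_ *: _); ring.
Qed.
Canonical loc_eq_equivrel := EquivRelPack loc_eq_equiv.
Canonical loc_eq_encModRel := defaultEncModRel loc_eq.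

Definition loc := {eq_quot loc_eq}.
HB.instance Definition _ : EqQuotient (M * denom)%type loc_eq loc :=
  EqQuotient.on loc.
HB.instance Definition _ := Choice.on loc.

Definition frac (x : M) (s : denom) : loc := \pi_loc (x, s).

Lemma frac_eqP x s y t :
  (exists u : denom, val u *: (val t *: x) = val u *: (val s *: y))
  <-> frac x s = frac y t.
Proof.
split=> [h|/eqmodP /= /asboolP //].
by apply/eqmodP/asboolP.
Qed.

Definition num (z : loc) : M := (repr z).1.
Definition den (z : loc) : denom := (repr z).2.

Lemma frac_num_den z : frac (num z) (den z) = z.
Proof. by rewrite /frac -surjective_pairing reprK. Qed.

Definition loc_add (z w : loc) : loc :=
  frac (val (den w) *: num z + val (den z) *: num w)
       (denom_mul (den z) (den w)).
Definition loc_zero : loc := frac 0 denom1.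
Definition loc_scale (a : R) (z : loc) : loc := frac (a *: num z) (den z).
Definition loc_opp (z : loc) : loc := loc_scale (-1) z.

Lemma loc_add_frac x s y t :
  loc_add (frac x s) (frac y t)
    = frac (val t *: x + val s *: y) (denom_mul s t).
Proof.
have /frac_eqP[u hu] := frac_num_den (frac x s).
have /frac_eqP[v hv] := frac_num_den (frac y t).
set x' := num _ in hu *; set s' := den _ in hu *.
rewrite /loc_add -/x' -/s'.
set y' := num _ in hv *; set t' := den _ in hv *.
apply/frac_eqP; exists (denom_mul u v); rewrite !denomE.
move: hu hv; rewrite !scalerDr !scalerA => hu hv; congr (_ + _).
  have -> : val u * val v * (val s * val t) * val t'
            = (val v * val t * val t') * (val u * val s) by ring.
  by rewrite -scalerA hu scalerA; congr (_ *: _); ring.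
have -> : val u * val v * (val s * val t) * val s'
          = (val u * val s * val s') * (val v * val t) by ring.
by rewrite -scalerA hv scalerA; congr (_ *: _); ring.
Qed.

Lemma loc_scale_frac a x s : loc_scale a (frac x s) = frac (a *: x) s.
Proof.
have /frac_eqP[u hu] := frac_num_den (frac x s).
apply/frac_eqP; exists u.
have sw (b c : R) (v : M) : b *: (c *: v) = c *: (b *: v).
  by rewrite !scalerA mulrC.
by rewrite !(sw _ a) hu.
Qed.

Lemma fracD x y s : frac (x + y) s = loc_add (frac x s) (frac y s).
Proof.
rewrite loc_add_frac; apply/frac_eqP; exists denom1; rewrite !denomE.
by rewrite -scalerDr !scale1r scalerA.
Qed.

Fact loc_addA : associative loc_add.
Proof.
move=> x y z; rewrite -(frac_num_den x) -(frac_num_den y) -(frac_num_den z).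
rewrite !loc_add_frac; apply/frac_eqP; exists denom1; rewrite !denomE.
rewrite !scale1r !scalerDr !scalerA addrA.
by congr (_ + _ + _); congr (_ *: _); ring.
Qed.
Fact loc_addC : commutative loc_add.
Proof.
move=> x y; rewrite -(frac_num_den x) -(frac_num_den y) !loc_add_frac.
apply/frac_eqP; exists denom1; rewrite !denomE.
by rewrite addrC [val (den y) * _]mulrC.
Qed.
Fact loc_add0 : left_id loc_zero loc_add.
Proof.
move=> x; rewrite -(frac_num_den x) loc_add_frac; apply/frac_eqP.
by exists denom1; rewrite !denomE scaler0 add0r !scale1r mul1r.
Qed.
Fact loc_addN : left_inverse loc_zero loc_opp loc_add.
Proof.
move=> x; rewrite -(frac_num_den x) /loc_opp loc_scale_frac loc_add_frac.
apply/frac_eqP; exists denom1.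
by rewrite !denomE scaleN1r scalerN addNr !scaler0.
Qed.
HB.instance Definition _ :=
  GRing.isZmodule.Build loc loc_addA loc_addC loc_add0 loc_addN.

Fact loc_scaleA a b (x : loc) :
  loc_scale a (loc_scale b x) = loc_scale (a * b) x.
Proof. by rewrite -(frac_num_den x) !loc_scale_frac scalerA. Qed.
Fact loc_scale1 : left_id 1 loc_scale.
Proof. by move=> x; rewrite -(frac_num_den x) loc_scale_frac scale1r. Qed.
Fact loc_scaleDr : right_distributive loc_scale +%R.
Proof.
move=> a x y; rewrite -(frac_num_den x) -(frac_num_den y).
rewrite [_ + _]loc_add_frac !loc_scale_frac [RHS]loc_add_frac.
by congr frac; rewrite scalerDr !scalerA ![a * _]mulrC.
Qed.
Fact loc_scaleDl (x : loc) : {morph loc_scale^~ x : a b / a + b}.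
Proof.
by move=> a b; rewrite -(frac_num_den x) !loc_scale_frac scalerDl fracD.
Qed.
HB.instance Definition _ :=
  GRing.Zmodule_isLmodule.Build R loc loc_scaleA loc_scale1 loc_scaleDr
    loc_scaleDl.

End LocalizedModule.

(* The maximal ideal p R_p of R_p, as an R-submodule. *)
Definition loc_max : {pred loc R^o} :=
  fun z => `[< exists (a : R) (s : denom), a \in p /\ z = frac (a : R^o) s >].

Fact loc_max_closed : subsemimod_closed loc_max.
Proof.
split; first split.
- by apply/asboolP; exists 0, denom1; split; first exact: idealr0.
- move=> x y /asboolP [a [s [pa ->]]] /asboolP [b [t [pb ->]]]; apply/asboolP.
  exists (val t * a + val s * b), (denom_mul s t); split.
    by rewrite rpredD // idealMr.
  by rewrite [LHS]loc_add_frac.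
- move=> c x /asboolP [a [s [pa ->]]]; apply/asboolP.
  exists (c * a), s; split; first by rewrite idealMr.
  by rewrite [LHS]loc_scale_frac.
Qed.
HB.instance Definition _ :=
  GRing.isSubmodClosed.Build R (loc R^o) loc_max loc_max_closed.

(* R_p / p R_p *)
Definition residue_field := quotm loc_max.
HB.instance Definition _ := GRing.Lmodule.on residue_field.

End Localization.

Section CommutativeAlgebra.
Variable R : comNzRingType.

Section IdealModule.
Variable I : idealr R.

Definition ideal_pred : {pred R^o} := fun x => x \in I.
Fact ideal_pred_closed : subsemimod_closed ideal_pred.
Proof.
split; first split.
- exact: idealr0.
- by move=> x y Ix Iy; apply: (rpredD (S := I)).
- by move=> a x Ix; apply: (idealMr a (u := x)).
Qed.
HB.instance Definition _ :=
  GRing.isSubmodClosed.Build R R^o ideal_pred ideal_pred_closed.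

(* R/I *)
Definition cyclic_mod := quotm ideal_pred.
HB.instance Definition _ := GRing.Lmodule.on cyclic_mod.

End IdealModule.

Definition fin_gen (V : lmodType R) :=
  exists n (g : 'I_n -> V),
    forall x, exists c : 'I_n -> R, x = \sum_(i < n) c i *: g i.

(* idealr consists of the proper ideals (the unit ideal is principal anyway). *)
Definition noetherian := forall I : idealr R, fin_gen (subm (ideal_pred I)).

(* m is the unique maximal ideal; J ranges over the proper ideals. *)
Definition local_ring (m : idealr R) := forall J : idealr R, {subset J <= m}.

Definition prime_chain (V : prime_idealr R -> Prop) (n : nat)
    (c : nat -> prime_idealr R) :=
  (forall i, (i <= n)%N -> V (c i)) /\
  (forall i, (i < n)%N ->
     {subset c i <= c i.+1} /\ ~ {subset c i.+1 <= c i}).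

Definition has_dim (V : prime_idealr R -> Prop) (n : nat) :=
  (exists c, prime_chain V n c) /\
  (forall k c, prime_chain V k c -> (k <= n)%N).

Definition krull_dim (n : nat) := has_dim (fun=> True) n.

(* dim R/I = n: the primes of R/I are identified with those containing I. *)
Definition quotient_dim (I : idealr R) (n : nat) :=
  has_dim (fun q => {subset I <= q}) n.

Definition injective_module (E : lmodType R) :=
  forall (A B : lmodType R) (i : {linear A -> B}) (f : {linear A -> E}),
    injective i -> exists g : {linear B -> E}, forall x, g (i x) = f x.

Definition projective_module (P : lmodType R) :=
  forall (A B : lmodType R) (q : {linear A -> B}) (f : {linear P -> B}),
    (forall y, exists x, q x = y) ->
    exists g : {linear P -> A}, forall x, q (g x) = f x.

Definition essential (M E : lmodType R) (f : {linear M -> E}) :=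
  forall S : submodClosed E, (exists2 y, y \in S & y != 0) ->
    exists2 x, f x \in S & f x != 0.

Definition injective_hull (M E : lmodType R) :=
  injective_module E /\
  exists f : {linear M -> E}, injective f /\ essential f.

(* D is the internal direct sum of the images of the injective maps *)
(* iota t : M t -> D with t in A. *)
Definition direct_sum (T : Type) (A : T -> Prop) (M : T -> lmodType R)
    (D : lmodType R) (iota : forall t, {linear M t -> D}) :=
  (forall x : D, exists n (t : 'I_n -> T) (y : forall i, M (t i)),
     (forall i, A (t i)) /\ x = \sum_(i < n) iota (t i) (y i)) /\
  (forall n (t : 'I_n -> T) (y : forall i, M (t i)),
     injective t -> (forall i, A (t i)) ->
     \sum_(i < n) iota (t i) (y i) = 0 -> forall i, y i = 0).

End CommutativeAlgebra.

(* A cochain complex has a map diff i j for every pair of degrees, which is *)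
(* zero unless j = i + 1; in this way no component needs to be transported *)
(* along an equality of degrees. The same encoding is used for the components *)
(* of the Hom complex. *)
Record complex (R : pzRingType) := Complex {
  cobj :> int -> lmodType R;
  diff : forall i j, {linear cobj i -> cobj j};
  diff_neq : forall i j x, i + 1 <> j -> diff i j x = 0;
  diff_diff : forall i j k x, diff j k (diff i j x) = 0
}.

Section Complexes.
Variable R : comNzRingType.
Implicit Types C D : complex R.

Record chain_map C D := ChainMap {
  cmap :> forall i, {linear C i -> D i};
  cmap_diff : forall i j x, cmap j (diff C i j x) = diff D i j (cmap i x)
}.

Definition cocycles C (n : int) := subm (ker_pred (diff C n (n + 1))).
HB.instance Definition _ C n := GRing.Lmodule.on (cocycles C n).

Definition boundary_pred C n : {pred cocycles C n} :=
  fun z => `[< exists y, val z = diff C (n - 1) n y >].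
Fact boundary_closed C n : subsemimod_closed (@boundary_pred C n).
Proof.
split; first split.
- by apply/asboolP; exists 0; rewrite linear0.
- move=> x y /asboolP [u xu] /asboolP [v yv]; apply/asboolP.
  by exists (u + v); rewrite linearD -xu -yv.
- move=> a x /asboolP [u xu]; apply/asboolP.
  by exists (a *: u); rewrite [RHS]linearZ; congr (_ *: _).
Qed.
HB.instance Definition _ C n :=
  GRing.isSubmodClosed.Build R (cocycles C n) (@boundary_pred C n)
    (@boundary_closed C n).

Definition cohomology C n := quotm (@boundary_pred C n).
HB.instance Definition _ C n := GRing.Lmodule.on (cohomology C n).

Section Functoriality.
Variables (C D : complex R) (f : chain_map C D) (n : int).

Fact cocycles_map_subproof (z : cocycles C n) :
  f n (val z) \in ker_pred (diff D n (n + 1)).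
Proof.
rewrite unfold_in -cmap_diff.
by have := valP z; rewrite unfold_in => /eqP ->; rewrite linear0.
Qed.
Definition cocycles_map (z : cocycles C n) : cocycles D n :=
  Subm (cocycles_map_subproof z).

Definition cohomology_map (h : cohomology C n) : cohomology D n :=
  cls (@boundary_pred D n) (cocycles_map (repr h)).

Lemma cohomology_map_cls z :
  cohomology_map (cls (@boundary_pred C n) z)
    = cls (@boundary_pred D n) (cocycles_map z).
Proof.
apply/cls_eqP/asboolP.
have /cls_eqP/asboolP[y hy] := cls_repr (cls (@boundary_pred C n) z).
by exists (f (n - 1) y); rewrite -cmap_diff -hy linearB linearB.
Qed.

End Functoriality.

Definition acyclic C := forall n (h : cohomology C n), h = 0.

Definition quasi_iso C D (f : chain_map C D) :=
  forall n, bijective (cohomology_map f (n := n)).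

(* An isomorphism in D(R) is a roof both of whose legs are quasi-isomorphisms:*)
(* a roof is invertible exactly when its second leg is a quasi-isomorphism. *)
Definition derived_iso C D :=
  exists (Z : complex R) (f : chain_map Z C) (g : chain_map Z D),
    quasi_iso f /\ quasi_iso g.

Definition sgn (n : int) : R := (-1) ^+ `|n|%N.

Lemma sgnS n : sgn (n + 1) = - sgn n.
Proof.
rewrite /sgn; case: (intP n) => [|k|k]; first by rewrite add0r expr1.
  by rewrite -[_ + 1]/(Posz (k.+1 + 1)) addn1 !absz_nat exprS mulN1r.
have -> : - (k.+1%:Z) + 1 = - k%:Z by rewrite -addn1 PoszD opprD addrNK.
by rewrite !abszN !absz_nat [in RHS]exprS mulN1r opprK.
Qed.

Section Single.
Variable M : lmodType R.

Definition single_obj (i : int) : lmodType R :=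
  match i with Posz 0 => M | _ => 'rV[R]_0 end.

Definition single : complex R :=
  @Complex R single_obj (fun i j => zero_map _ _)
    (fun _ _ _ _ => erefl) (fun _ _ _ _ => erefl).

Section FromSingle.
Variables (D : complex R) (f : {linear M -> D 0}).
Hypothesis df : forall j x, diff D 0 j (f x) = 0.

Definition from_single_map (i : int) : {linear single i -> D i} :=
  match i return {linear single_obj i -> D i} with
  | Posz 0 => f
  | Posz k.+1 => zero_map 'rV[R]_0 (D k.+1%:Z)
  | Negz k => zero_map 'rV[R]_0 (D (Negz k))
  end.

Fact from_single_diff i j x :
  from_single_map j (diff single i j x) = diff D i j (from_single_map i x).
Proof.
rewrite [diff single i j x]/= linear0; case: i x => [[|k]|k] x /=.
- by rewrite df.
- by rewrite linear0.
- by rewrite linear0.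
Qed.

Definition from_single : chain_map single D := ChainMap from_single_diff.

End FromSingle.
End Single.

Section Shift.
Variables (C : complex R) (k : int).

Fact shift_diff_linear i j :
  linear (fun x => sgn k *: diff C (i + k) (j + k) x).
Proof. by move=> a x y; rewrite linearP scalerDr !scalerA mulrC. Qed.

Definition shift_diff i j : {linear C (i + k) -> C (j + k)} :=
  lin_of (@shift_diff_linear i j).

Fact shift_diff_neq i j x : i + 1 <> j -> shift_diff i j x = 0.
Proof.
move=> ij /=; rewrite diff_neq ?scaler0 // addrAC => e.
by apply: ij; apply: addIr e.
Qed.
Fact shift_diff_diff i j l x : shift_diff j l (shift_diff i j x) = 0.
Proof. by rewrite /= linearZ /= diff_diff !scaler0. Qed.

(* (C[k])^i = C^(i+k) with differential (-1)^k d *)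
Definition shift : complex R :=
  @Complex R (fun i => C (i + k)) shift_diff shift_diff_neq shift_diff_diff.

End Shift.

Section TruncationLe.
Variables (n : int) (X : complex R).

Definition trunc_le_pred (i : int) : {pred X i} := fun x =>
  `[< (n < i -> x = 0) /\ (i = n -> diff X i (i + 1) x = 0) >].
Fact trunc_le_closed i : subsemimod_closed (@trunc_le_pred i).
Proof.
split; first split.
- by apply/asboolP; split=> // _; rewrite linear0.
- move=> x y /asboolP [x0 dx] /asboolP [y0 dy]; apply/asboolP; split=> h.
    by rewrite x0 // y0 // addr0.
  by rewrite linearD dx // dy // addr0.
- move=> a x /asboolP [x0 dx]; apply/asboolP; split=> h.
    by rewrite x0 // scaler0.
  by rewrite linearZ /= dx // scaler0.
Qed.
HB.instance Definition _ i :=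
  GRing.isSubmodClosed.Build R (X i) (@trunc_le_pred i) (@trunc_le_closed i).

Definition trunc_le_obj i := subm (@trunc_le_pred i).
HB.instance Definition _ i := GRing.Lmodule.on (trunc_le_obj i).

Fact trunc_le_diff_subproof i j (x : trunc_le_obj i) :
  diff X i j (val x) \in @trunc_le_pred j.
Proof.
have /asboolP[x0 dx] := valP x.
apply/asboolP; split=> [nj|_]; last by rewrite diff_diff.
have [ij|/eqP ij] := eqVneq (i + 1) j; last by rewrite diff_neq.
subst j; move: nj; rewrite ltzD1 le_eqVlt => /orP[/eqP ni|ni].
  by rewrite dx.
by rewrite x0 // linear0.
Qed.
Definition trunc_le_diff_fun i j (x : trunc_le_obj i) : trunc_le_obj j :=
  Subm (trunc_le_diff_subproof j x).
Fact trunc_le_diff_linear i j : linear (@trunc_le_diff_fun i j).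
Proof. by move=> a x y; apply: val_inj; rewrite /= linearP. Qed.

Definition trunc_le_diff i j : {linear trunc_le_obj i -> trunc_le_obj j} :=
  lin_of (@trunc_le_diff_linear i j).

Fact trunc_le_diff_neq i j x : i + 1 <> j -> trunc_le_diff i j x = 0.
Proof. by move=> ij; apply: val_inj; rewrite /= diff_neq. Qed.
Fact trunc_le_diff_diff i j k x :
  trunc_le_diff j k (trunc_le_diff i j x) = 0.
Proof. by apply: val_inj; rewrite /= diff_diff. Qed.

(* ... -> X^(n-1) -> Ker d^n -> 0 -> ... *)
Definition trunc_le : complex R :=
  @Complex R (fun i => trunc_le_obj i) trunc_le_diff
    trunc_le_diff_neq trunc_le_diff_diff.

End TruncationLe.

Section TruncationGt.
Variables (n : int) (X : complex R).

(* The component of degree i is U (+) W, where U is X^i if i > n and 0 *)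
(* otherwise, and W, a submodule of X^(i+1), is Im d^n if i = n and 0 *)
(* otherwise. *)
Definition trunc_gt_pred (i : int) : {pred (X i * X (i + 1)%R)%type} :=
  fun p => `[< (i <= n -> p.1 = 0) /\
               (if i == n then exists x, p.2 = diff X i (i + 1) x
                else p.2 = 0) >].
Fact trunc_gt_closed i : subsemimod_closed (@trunc_gt_pred i).
Proof.
rewrite /trunc_gt_pred; split; first split.
- apply/asboolP; split=> //=; case: ifP => // _.
  by exists 0; rewrite linear0.
- move=> p q /asboolP [p1 p2] /asboolP [q1 q2]; apply/asboolP.
  split=> [h|] /=; first by rewrite p1 // q1 // addr0.
  case: ifP p2 q2 => _; last by move=> -> ->; rewrite addr0.
  by move=> [x ->] [y ->]; exists (x + y); rewrite linearD.
- move=> a p /asboolP [p1 p2]; apply/asboolP.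
  split=> [h|] /=; first by rewrite p1 // scaler0.
  case: ifP p2 => _; last by move=> ->; rewrite scaler0.
  by move=> [x ->]; exists (a *: x); rewrite linearZ.
Qed.
HB.instance Definition _ i :=
  GRing.isSubmodClosed.Build R (X i * X (i + 1)%R)%type (@trunc_gt_pred i)
    (@trunc_gt_closed i).

Definition trunc_gt_obj i := subm (@trunc_gt_pred i).
HB.instance Definition _ i := GRing.Lmodule.on (trunc_gt_obj i).

Definition trunc_gt_diff_pair i j (p : trunc_gt_obj i) : X j * X (j + 1) :=
  (diff X i j (val p).1 + eqmap X (i + 1) j (val p).2, 0).

Fact trunc_gt_diff_subproof i j (p : trunc_gt_obj i) :
  trunc_gt_diff_pair j p \in @trunc_gt_pred j.
Proof.
have /asboolP[p1 p2] := valP p.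
apply/asboolP; split=> [jn|] /=; last first.
  by case: ifP => // _; exists 0; rewrite linear0.
have [ij|/eqP ij] := eqVneq (i + 1) j; last by rewrite diff_neq // eqmap_neq ?addr0.
subst j; have lin : i < n by rewrite -lezD1.
by rewrite p1 ?ltW // linear0; move: p2; rewrite lt_eqF // => ->; rewrite linear0 addr0.
Qed.
Definition trunc_gt_diff_fun i j (p : trunc_gt_obj i) : trunc_gt_obj j :=
  Subm (trunc_gt_diff_subproof j p).
Fact trunc_gt_diff_linear i j : linear (@trunc_gt_diff_fun i j).
Proof.
move=> a p q; apply: val_inj; congr pair => /=; last by rewrite scaler0 addr0.
by rewrite !linearP scalerDr addrACA.
Qed.

Definition trunc_gt_diff i j : {linear trunc_gt_obj i -> trunc_gt_obj j} :=
  lin_of (@trunc_gt_diff_linear i j).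

Fact trunc_gt_diff_neq i j p : i + 1 <> j -> trunc_gt_diff i j p = 0.
Proof.
move=> ij; apply: val_inj; congr pair => /=.
by rewrite diff_neq // eqmap_neq ?addr0.
Qed.
Fact trunc_gt_diff_diff i j k p :
  trunc_gt_diff j k (trunc_gt_diff i j p) = 0.
Proof.
apply: val_inj; congr pair => /=.
rewrite linear0 addr0 linearD diff_diff add0r.
have /asboolP[_] := valP p; case: ifP => [_ [x ->]|_ ->]; last by rewrite !linear0.
have [ij|/eqP ij] := eqVneq (i + 1) j; last by rewrite eqmap_neq // linear0.
by subst j; rewrite eqmap_id diff_diff.
Qed.

(* ... -> 0 -> Im d^n -> X^(n+1) -> X^(n+2) -> ... *)
Definition trunc_gt : complex R :=
  @Complex R (fun i => trunc_gt_obj i) trunc_gt_diff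
    trunc_gt_diff_neq trunc_gt_diff_diff.

End TruncationGt.

Section HomComplex.
Variables C D : complex R.

Section HomModule.
Variable n : int.

Record hom := Hom {
  hfun :> forall i j, C i -> D j;
  hfun_linear : forall i j, linear (@hfun i j);
  hfun_neq : forall i j x, i + n <> j -> @hfun i j x = 0
}.

Lemma homP (f g : hom) : (forall i j x, f i j x = g i j x) -> f = g.
Proof.
case: f g => [f fL f0] [g gL g0] /= fg.
have e : f = g.
  by apply: functional_extensionality_dep => i;
     apply: functional_extensionality_dep => j; apply/funext => x; apply: fg.
by subst g; congr Hom; apply: Prop_irrelevance.
Qed.

HB.instance Definition _ := gen_eqMixin hom.
HB.instance Definition _ := gen_choiceMixin hom.
HB.instance Definition _ (f : hom) i j :=
  GRing.isLinear.Build R (C i) (D j) *:%R (f i j) (@hfun_linear f i j).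

Fact hom_zero_linear i j : linear (fun _ : C i => 0 : D j).
Proof. by move=> a x y; rewrite scaler0 addr0. Qed.
Definition hom_zero : hom := Hom hom_zero_linear (fun _ _ _ _ => erefl).

Fact hom_add_linear (f g : hom) i j : linear (fun x => f i j x + g i j x).
Proof. by move=> a x y; rewrite !linearP scalerDr addrACA. Qed.
Fact hom_add_neq (f g : hom) i j x : i + n <> j -> f i j x + g i j x = 0.
Proof. by move=> ij; rewrite !hfun_neq ?addr0. Qed.
Definition hom_add (f g : hom) : hom :=
  Hom (hom_add_linear f g) (@hom_add_neq f g).

Fact hom_scale_linear a (f : hom) i j : linear (fun x => a *: f i j x).
Proof. by move=> b x y; rewrite linearP scalerDr !scalerA mulrC. Qed.
Fact hom_scale_neq a (f : hom) i j x : i + n <> j -> a *: f i j x = 0.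
Proof. by move=> ij; rewrite hfun_neq ?scaler0. Qed.
Definition hom_scale (a : R) (f : hom) : hom :=
  Hom (hom_scale_linear a f) (@hom_scale_neq a f).

Definition hom_opp (f : hom) : hom := hom_scale (-1) f.

Fact hom_addA : associative hom_add.
Proof. by move=> f g h; apply: homP => i j x /=; rewrite addrA. Qed.
Fact hom_addC : commutative hom_add.
Proof. by move=> f g; apply: homP => i j x /=; rewrite addrC. Qed.
Fact hom_add0 : left_id hom_zero hom_add.
Proof. by move=> f; apply: homP => i j x /=; rewrite add0r. Qed.
Fact hom_addN : left_inverse hom_zero hom_opp hom_add.
Proof. by move=> f; apply: homP => i j x /=; rewrite scaleN1r addNr. Qed.
HB.instance Definition _ :=
  GRing.isZmodule.Build hom hom_addA hom_addC hom_add0 hom_addN.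

Fact hom_scaleA a b f : hom_scale a (hom_scale b f) = hom_scale (a * b) f.
Proof. by apply: homP => i j x /=; rewrite scalerA. Qed.
Fact hom_scale1 : left_id 1 hom_scale.
Proof. by move=> f; apply: homP => i j x /=; rewrite scale1r. Qed.
Fact hom_scaleDr : right_distributive hom_scale +%R.
Proof. by move=> a f g; apply: homP => i j x /=; rewrite scalerDr. Qed.
Fact hom_scaleDl f : {morph hom_scale^~ f : a b / a + b}.
Proof. by move=> a b; apply: homP => i j x /=; rewrite scalerDl. Qed.
HB.instance Definition _ :=
  GRing.Zmodule_isLmodule.Build R hom hom_scaleA hom_scale1 hom_scaleDr
    hom_scaleDl.

End HomModule.

Section HomDiff.
Variables (m n : int) (f : hom m).

(* d f = d_D o f - (-1)^m f o d_C for f of degree m, if n = m + 1 *)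
Definition hom_diff_comp i j (x : C i) : D j :=
  if m + 1 == n then
    diff D (j - 1) j (f i (j - 1) x)
      - sgn m *: f (i + 1) j (diff C i (i + 1) x)
  else 0.

Fact hom_diff_comp_linear i j : linear (@hom_diff_comp i j).
Proof.
move=> a x y; rewrite /hom_diff_comp.
case: eqP => _; last by rewrite scaler0 addr0.
by rewrite !linearP /= scalerDr addrACA scalerN.
Qed.

Fact hom_diff_comp_neq i j (x : C i) : i + n <> j -> hom_diff_comp j x = 0.
Proof.
rewrite /hom_diff_comp => ij; case: eqP => // mn.
rewrite (@hfun_neq _ f i (j - 1)); last by move=> e; apply: ij; lia.
rewrite (@hfun_neq _ f (i + 1) j); last by move=> e; apply: ij; lia.
by rewrite linear0 scaler0 subr0.
Qed.

Definition hom_diff_fun : hom n := Hom hom_diff_comp_linear hom_diff_comp_neq.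

End HomDiff.

Fact hom_diff_linear m n : linear (@hom_diff_fun m n).
Proof.
move=> a f g; apply: homP => i j x; rewrite /= /hom_diff_comp.
case: eqP => _; last by rewrite scaler0 addr0.
rewrite linearP !scalerDr !scalerN opprD addrACA !scalerA.
by rewrite [sgn m * a]mulrC.
Qed.

Definition hom_diff m n : {linear hom m -> hom n} :=
  lin_of (@hom_diff_linear m n).

Fact hom_diff_neq m n f : m + 1 <> n -> hom_diff m n f = 0.
Proof.
by move=> mn; apply: homP => i j x; rewrite /= /hom_diff_comp; case: eqP.
Qed.

Fact hom_diff_diff m n k f : hom_diff n k (hom_diff m n f) = 0.
Proof.
apply: homP => i j x; rewrite /= /hom_diff_comp /= /hom_diff_comp.
case: eqP => // nk; case: eqP => [mn|_]; last first.
  by rewrite linear0 scaler0 subr0.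
subst n; rewrite sgnS [diff C (i + 1) _ _]diff_diff linear0 scaler0 subr0.
by rewrite linearB diff_diff linearZ /= sub0r scaleNr opprK addNr.
Qed.

Definition homc : complex R :=
  @Complex R (fun n => hom n) hom_diff hom_diff_neq hom_diff_diff.

End HomComplex.

Section TensorComplex.
Variables (C : complex R) (N : lmodType R).

Fact tensc_diff_neq i j (x : tensor (C i) N) :
  i + 1 <> j -> tmap N (diff C i j) x = 0.
Proof.
move=> ij; rewrite -(tcls_repr x); apply: tmap_cls0 => m.
by rewrite diff_neq.
Qed.

Fact tensc_diff_diff i j k (x : tensor (C i) N) :
  tmap N (diff C j k) (tmap N (diff C i j) x) = 0.
Proof.
rewrite -(tcls_repr x); set y := repr x.
have -> : tmap N (diff C i j) (tcls y) = tcls (tmap_seq (diff C i j) y).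
  exact: tmap_cls.
have -> : tmap N (diff C j k) (tcls (tmap_seq (diff C i j) y))
    = tcls (tmap_seq (diff C j k) (tmap_seq (diff C i j) y)).
  exact: tmap_cls.
have -> : tmap_seq (diff C j k) (tmap_seq (diff C i j) y)
    = tmap_seq (N := N) (zero_map (C i) (C k)) y.
  by rewrite /tmap_seq -map_comp; apply: eq_map => t /=; rewrite diff_diff.
by rewrite -tmap_cls; apply: tmap_cls0.
Qed.

Definition tensc : complex R :=
  @Complex R (fun i => tensor (C i) N) (fun i j => tmap N (diff C i j))
    tensc_diff_neq tensc_diff_diff.

End TensorComplex.

Definition semi_injective (J : complex R) :=
  (forall i, injective_module (J i)) /\
  (forall A : complex R, acyclic A -> acyclic (homc A J)).

Definition semi_projective (P : complex R) :=
  (forall i, projective_module (P i)) /\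
  (forall A : complex R, acyclic A -> acyclic (homc P A)).

Record semi_injective_resolution (Y : complex R) := SemiInjectiveResolution {
  inj_res : complex R;
  inj_res_map : chain_map Y inj_res;
  inj_res_semi_injective : semi_injective inj_res;
  inj_res_quasi_iso : quasi_iso inj_res_map
}.

Record semi_projective_resolution (X : complex R) := SemiProjectiveResolution {
  proj_res : complex R;
  proj_res_map : chain_map proj_res X;
  proj_res_semi_projective : semi_projective proj_res;
  proj_res_quasi_iso : quasi_iso proj_res_map
}.

(* RHom(X, Y), computed by the resolution J of Y *)
Definition RHom (X Y : complex R) (J : semi_injective_resolution Y) :=
  homc X (inj_res J).

(* The derived tensor product of X and N, computed by the resolution P of X *)
Definition Ltensor (X : complex R) (P : semi_projective_resolution X)
    (N : lmodType R) := tensc (proj_res P) N.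

(* The small support. Two semi-projective resolutions of X are homotopy *)
(* equivalent, so that quantifying over all of them amounts to choosing one. *)
Definition small_supp (X : complex R) (p : prime_idealr R) :=
  forall P : semi_projective_resolution X,
    ~ acyclic (Ltensor P (residue_field p)).

Section Homothety.
Variable C : complex R.

Fact hom_id_linear i j : linear (eqmap C i j).
Proof. exact: linearP. Qed.
Fact hom_id_neq i j x : i + 0 <> j -> eqmap C i j x = 0.
Proof. by rewrite addr0 => ij; apply: eqmap_neq. Qed.
Definition hom_id : hom C C 0 := Hom hom_id_linear hom_id_neq.

Fact homothety_linear : linear (fun r : R^o => (r : R) *: hom_id).
Proof. by move=> a x y; rewrite scalerDl scalerA. Qed.
Definition homothety0 : {linear R^o -> homc C C 0} := lin_of homothety_linear.

Fact homothety0_diff n r : diff (homc C C) 0 n (homothety0 r) = 0.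
Proof.
rewrite linearZ; apply/eqP; rewrite /= -[X in _ == X](scaler0 _ r); apply/eqP.
congr (_ *: _); apply: homP => i j x; rewrite /= /hom_diff_comp /=.
case: eqP => // _; rewrite scale1r.
have [<-|/eqP ij] := eqVneq (i + 1) j.
  by rewrite addrK !eqmap_id subrr.
rewrite (eqmap_neq _ ij) subr0.
have [e|/eqP e] := eqVneq i (j - 1); last by rewrite eqmap_neq // linear0.
by case: ij; rewrite e subrK.
Qed.

(* R -> Hom(C, C), r |-> r id *)
Definition homothety : chain_map (single R^o) (homc C C) :=
  from_single homothety0_diff.

End Homothety.

(* For a bounded complex of injective modules I, RHom(I, I) = Hom(I, I). *)
Definition dualizing_complex (I : complex R) :=
  [/\ exists a b : int, forall i, (i < a) || (b < i) -> forall x : I i, x = 0,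
      forall i, injective_module (I i),
      forall i, fin_gen (cohomology I i) &
      quasi_iso (homothety I)].

(* I^i is the direct sum of the E(R/p), dim R/p = d - i; in particular it is *)
(* zero unless 0 <= i <= d. *)
Definition normalized (d : nat) (I : complex R) :=
  forall i : int,
    let A (p : prime_idealr R) :=
      exists n : nat, n%:Z = d%:Z - i /\ quotient_dim p n in
    exists (M : prime_idealr R -> lmodType R)
           (iota : forall p, {linear M p -> I i}),
      (forall p, A p -> injective_hull (cyclic_mod p) (M p)) /\
      direct_sum A iota.

End Complexes.

(* Main.v *)
Require Import Defs.
From HB Require Import structures.
From mathcomp Require Import all_boot all_order all_algebra.
From mathcomp Require Import generic_quotient ring_quotient.
From mathcomp Require Import boolp functions.
From mathcomp Require Import zify ring.

(** Let I' be the part of I in degrees < d. As I^d = E, there is an exact sequence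
    E[-d] -> I -> I' of complexes of injectives, so it is enough that RHom(X, I')
    has no cohomology in degrees >= d. A cocycle of Hom(X, I') of such a degree only
    involves maps X^j -> I^k with j < 0 and k < d; these are removed successively by
    homotopies, because every linear map from H^j(X) to I^k vanishes: an element of
    I^k, a sum of hulls E(R/q) with q <> m, is zero as soon as it is killed by an
    element outside p for every prime p <> m.

    That H^j(X)_p = 0 for p <> m and j < 0 is deduced from the small support as
    follows. Let P be a semi-projective resolution of the truncation of X. By
    Noetherian induction H(P/JP)_p = 0 for all ideals J, the case J = 0 being the
    claim. If ab lies in J but a, b do not, use R/(J:a), R/J and R/(J+a). If J is a
    prime q <> m, every a outside q acts injectively on H(P/qP)_p by induction, and
    this module becomes zero after inverting all such a, since P (x) k(q) is acyclic.
    If J = m, the module is killed by an element of m outside p. *)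

Set Implicit Arguments.
Unset Strict Implicit.
Unset Printing Implicit Defensive.

Import Order.TTheory GRing.Theory Num.Theory.
Local Open Scope ring_scope.

Local Notation hom := Defs.hom.
Local Notation Hom := Defs.Hom.
Local Notation frac := Defs.frac.

Lemma cls0 (R : pzRingType) (V : lmodType R) (S : submodClosed V) :
  cls S 0 = 0.
Proof. by apply: (addrI (cls S 0)); rewrite -clsD !addr0. Qed.

(** * Cocycles and coboundaries on elements *)

Section ElementwiseCohomology.
Variable R : comNzRingType.
Implicit Types A B C D X Y : complex R.

(** All target degrees are allowed, so that no successor degree has to be written in a fixed form;
    by [diff_neq] only one of the conditions has content. *)
Definition cocycle C n (x : C n) := forall j, diff C n j x = 0.
Definition coboundary C n (x : C n) := exists j y, x = diff C j n y.

Lemma cocycleP C n (x : C n) : diff C n (n + 1) x = 0 <-> cocycle x.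
Proof.
split=> [dx j|]; last exact.
have [<-//|/eqP nj] := eqVneq (n + 1) j.
by rewrite diff_neq.
Qed.

Lemma coboundaryP C n (x : C n) k : k + 1 = n ->
  coboundary x -> exists y : C k, x = diff C k n y.
Proof.
move=> kn [j [y ->]]; have [jn|/eqP jn] := eqVneq (j + 1) n.
  have -> : k = j by lia.
  by exists y.
by exists 0; rewrite linear0 diff_neq.
Qed.

Lemma coboundary_pred_diff C n (x : C n) : coboundary x ->
  exists y, x = diff C (n - 1) n y.
Proof. by apply: coboundaryP; rewrite subrK. Qed.

Lemma coboundary0 C n : coboundary (0 : C n).
Proof. by exists n, 0; rewrite linear0. Qed.

Lemma coboundary_diff C j n (y : C j) : coboundary (diff C j n y).
Proof. by exists j, y. Qed.

Lemma coboundaryD C n (x y : C n) :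
  coboundary x -> coboundary y -> coboundary (x + y).
Proof.
move=> /coboundary_pred_diff[u ->] /coboundary_pred_diff[v ->].
by rewrite -linearD; apply: coboundary_diff.
Qed.

Lemma coboundaryZ C n a (x : C n) : coboundary x -> coboundary (a *: x).
Proof.
by move=> [j [y ->]]; rewrite -[_ *: _]linearZ; apply: coboundary_diff.
Qed.

Lemma coboundaryN C n (x : C n) : coboundary x -> coboundary (- x).
Proof. by rewrite -scaleN1r; apply: coboundaryZ. Qed.

Lemma cocycleD C n (x y : C n) : cocycle x -> cocycle y -> cocycle (x + y).
Proof. by move=> cx cy j; rewrite linearD cx cy addr0. Qed.

Lemma cocycleN C n (x : C n) : cocycle x -> cocycle (- x).
Proof. by move=> cx j; rewrite linearN cx oppr0. Qed.

Lemma cocycle_map C D (f : chain_map C D) n (x : C n) :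
  cocycle x -> cocycle (f n x).
Proof. by move=> cx j; rewrite -cmap_diff cx linear0. Qed.

Definition cocycle_of C n (x : C n) (cx : cocycle x) : cocycles C n.
Proof. by exists x; apply/eqP/cocycleP. Defined.

Lemma cocycle_val C n (z : cocycles C n) : cocycle (val z).
Proof. by apply/cocycleP/eqP; have := valP z. Qed.

Definition cohomology_class C n (z : cocycles C n) : cohomology C n :=
  cls (@boundary_pred R C n) z.

Lemma cohomology_class_eq C n (x y : cocycles C n) :
  cohomology_class x = cohomology_class y <-> coboundary (val x - val y).
Proof.
split=> [/cls_eqP/asboolP[u xy]|/coboundary_pred_diff[u xy]].
  by rewrite -[val x - val y]/(val (x - y)) xy; apply: coboundary_diff.
by apply/cls_eqP/asboolP; exists u.
Qed.

Lemma cohomology_class0 C n : cohomology_class (0 : cocycles C n) = 0.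
Proof. exact: cls0. Qed.

Lemma cohomology_class_repr C n (h : cohomology C n) :
  cohomology_class (repr h) = h.
Proof. exact: cls_repr. Qed.

Lemma cohomology_map_class C D (f : chain_map C D) n (z : cocycles C n) :
  cohomology_map f (cohomology_class z)
    = cohomology_class (cocycles_map f z).
Proof. exact: cohomology_map_cls. Qed.

Definition exact_at C n := forall x : C n, cocycle x -> coboundary x.

Lemma acyclicP C : acyclic C <-> forall n, exact_at C n.
Proof.
split=> [aC n x cx|aC n h].
  have := aC n (cohomology_class (cocycle_of cx)).
  by rewrite -cohomology_class0 => /cohomology_class_eq; rewrite subr0.
rewrite -(cohomology_class_repr h) -cohomology_class0.
apply/cohomology_class_eq; rewrite subr0.
exact/aC/cocycle_val.
Qed.

(** Bijectivity of H^n(f) on representatives. It is stated for a single degree because the truncated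
    comparison below holds only in positive degrees. *)
Definition cohomology_iso_at C D (f : chain_map C D) n :=
  (forall x : C n, cocycle x -> coboundary (f n x) -> coboundary x) /\
  (forall y : D n, cocycle y ->
     exists2 x : C n, cocycle x & coboundary (f n x - y)).

Lemma quasi_isoP C D (f : chain_map C D) :
  quasi_iso f <-> forall n, cohomology_iso_at f n.
Proof.
split=> [qf n|qf n].
  have [g fK gK] := qf n; split=> [x cx bx|y cy].
    have : cohomology_map f (cohomology_class (cocycle_of cx))
        = cohomology_map f (cohomology_class 0).
      rewrite !cohomology_map_class; apply/cohomology_class_eq.
      by rewrite /= linear0 subr0.
    by move=> /(can_inj fK) /cohomology_class_eq; rewrite subr0.
  have := gK (cohomology_class (cocycle_of cy)); set h := g _.
  rewrite -(cohomology_class_repr h) cohomology_map_class => /cohomology_class_eq /= bxy.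
  by exists (val (repr h)) => //; apply: cocycle_val.
have [qi qs] := qf n.
have inj : injective (cohomology_map f (n := n)).
  move=> x y; rewrite -(cohomology_class_repr x) -(cohomology_class_repr y).
  rewrite !cohomology_map_class.
  move=> /cohomology_class_eq; rewrite /= -linearB => bxy; apply/cohomology_class_eq.
  apply: qi => //; exact: (cocycle_val (repr x - repr y)).
have surj y : exists x, cohomology_map f (n := n) x = y.
  have [x cx bx] := qs _ (cocycle_val (repr y)).
  exists (cohomology_class (cocycle_of cx)).
  by rewrite -[RHS]cohomology_class_repr cohomology_map_class; apply/cohomology_class_eq.
exists (fun y => projT1 (cid (surj y))) => x; last by case: cid.
by apply: inj; case: cid.
Qed.

Definition comp_map A B C (g : chain_map B C) (f : chain_map A B) :
  chain_map A C.
Proof.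
exists (fun i => lin_of (linearP (g i \o f i))) => i j x /=.
by rewrite !cmap_diff.
Defined.

Lemma cohomology_iso_at_comp A B C (g : chain_map B C) (f : chain_map A B) n :
  cohomology_iso_at f n -> cohomology_iso_at g n ->
  cohomology_iso_at (comp_map g f) n.
Proof.
move=> [fi fs] [gi gs]; split=> [x cx /gi bx|z cz].
  by apply: fi => //; apply/bx/cocycle_map.
have [y cy by_] := gs z cz; have [x cx bx] := fs y cy.
exists x => //=; rewrite -(subrK (g n y) (g n (f n x))) -addrA.
apply: coboundaryD => //; rewrite -linearB; case: bx => j [w ->].
by rewrite cmap_diff; apply: coboundary_diff.
Qed.

Lemma acyclic_bijective C D (f : chain_map C D) :
  (forall n, injective (f n)) -> (forall n y, exists x, f n x = y) ->
  acyclic C <-> acyclic D.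
Proof.
move=> fi fs; rewrite !acyclicP; split=> [aC|aD] n.
  move=> y cy; have [x fx] := fs n y.
  have [|j [w xw]] := aC n x.
    by move=> j; apply: (fi); rewrite cmap_diff fx cy linear0.
  by rewrite -fx xw cmap_diff; apply: coboundary_diff.
move=> x /(cocycle_map f) /aD[j [y]]; have [w <-] := fs j y.
by rewrite -cmap_diff => /fi ->; apply: coboundary_diff.
Qed.

End ElementwiseCohomology.

(** * Hom complexes into complexes of injective modules *)

Section LinearExtension.
Variable R : pzRingType.

Lemma quot_lift (V W : lmodType R) (S : submodClosed V) (f : {linear V -> W}) :
  (forall x, x \in S -> f x = 0) ->
  exists g : {linear quotm S -> W}, forall x, g (cls S x) = f x.
Proof.
move=> fS; pose h (x : quotm S) := f (repr x).
have hE x : h (cls S x) = f x.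
  apply/eqP; rewrite -subr_eq0 -linearB fS //.
  by apply/cls_eqP; rewrite cls_repr.
have hL : linear h.
  move=> a x y; rewrite -(cls_repr x) -(cls_repr y).
  by rewrite [a *: _]qscale_cls -clsD !hE linearP.
by exists (lin_of hL) => x; rewrite -hE.
Qed.

End LinearExtension.

Section HomComplexes.
Variable R : comNzRingType.
Implicit Types A B C D J X Y : complex R.

(** Both maps factor through A / ker u, which embeds into B; injectivity of N then extends the map
    induced by f. *)
Lemma injective_extend (A B N : lmodType R) (u : {linear A -> B})
    (f : {linear A -> N}) : injective_module N ->
  (forall x, u x = 0 -> f x = 0) ->
  exists g : {linear B -> N}, forall x, g (u x) = f x.
Proof.
move=> injN uf; have uS x : x \in ker_pred u -> u x = 0 by move/eqP.
have [u' u'E] := quot_lift uS.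
have [f' f'E] := quot_lift (fun x kx => uf x (uS x kx)).
have u'_inj : injective u'.
  move=> x y; rewrite -(cls_repr x) -(cls_repr y) !u'E => /eqP.
  by rewrite -subr_eq0 -linearB => xy; apply/cls_eqP.
have [g gE] := injN _ _ u' f' u'_inj.
by exists g => x; rewrite -u'E gE f'E.
Qed.

Lemma eqmap_diff C i j k x : j = k -> eqmap C j k (diff C i j x) = diff C i k x.
Proof. by move=> jk; subst k; rewrite eqmap_id. Qed.

(** Taking the neighbouring degrees as variables bound by equations avoids transports when the
    formula is used. *)
Lemma hom_diffE X Y m n (f : hom X Y m) i j k l (x : X i) :
  m + 1 = n -> k + 1 = j -> i + 1 = l ->
  diff (homc X Y) m n f i j x
    = diff Y k j (f i k x) - sgn R m *: f l j (diff X i l x).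
Proof.
move=> mn kj il; subst n j l; rewrite /= /hom_diff_comp eqxx.
by have -> : k + 1 - 1 = k by lia.
Qed.

Lemma sgnM m n : sgn R m * sgn R n = sgn R (m + n).
Proof.
have sgnB1 k : sgn R (k - 1) = - sgn R k by rewrite -[in RHS](subrK 1 k) sgnS opprK.
elim/int_rec: n => [|n IH|n IH]; first by rewrite addr0 mulr1.
- by rewrite -addn1 PoszD addrA !sgnS mulrN IH.
- by rewrite -addn1 PoszD opprD addrA !sgnB1 mulrN IH.
Qed.

Lemma sgnMs m : sgn R m * sgn R m = 1.
Proof. by rewrite /sgn -exprD addnn -mul2n exprM sqrrN expr1n expr1n. Qed.

Section PostComposition.
Variables (X A B : complex R) (e : chain_map A B).

Definition post_hom n (f : hom X A n) : hom X B n.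
Proof.
exists (fun i j x => e j (f i j x)) => [i j|i j x ij].
  by move=> a x y; rewrite !linearP.
by rewrite hfun_neq // linear0.
Defined.

Fact post_hom_linear n : linear (@post_hom n).
Proof. by move=> a f g; apply: homP => i j x /=; rewrite linearP. Qed.

Definition post_map : chain_map (homc X A) (homc X B).
Proof.
exists (fun n => lin_of (@post_hom_linear n)) => m n f.
have [mn|/eqP mn] := eqVneq (m + 1) n; last by rewrite !diff_neq // linear0.
apply: homP => i j x.
rewrite (hom_diffE _ _ mn (subrK 1 j) erefl) /=.
by rewrite /hom_diff_comp /= mn eqxx linearB linearZ /= cmap_diff.
Defined.

End PostComposition.

Section ClearComponents.
Variables (X J : complex R) (n b : int).

Definition vanish_below m k (f : hom X J m) :=
  forall i j x, j < k -> f i j x = 0.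

(** Flanking g by two [eqmap]s makes it the only component that can be nonzero. *)
Lemma elementary_hom i k (g : {linear X (i + 1) -> J k}) : i + n = k ->
  exists h : hom X J (n - 1),
    [/\ forall x, h (i + 1) k x = g x,
        forall j l x, j <> i + 1 -> h j l x = 0 &
        forall j l x, l <> k -> h j l x = 0].
Proof.
move=> ik; pose h j l x := eqmap J k l (g (eqmap X j (i + 1) x)).
have hL j l : linear (@h j l) by move=> a x y; rewrite /h !linearP.
have h0 j l x : j + (n - 1) <> l -> @h j l x = 0.
  move=> jl; have [e|/eqP e] := eqVneq k l; last by rewrite /h eqmap_neq.
  by rewrite /h (@eqmap_neq _ _ j) ?linear0 //; lia.
exists (Hom hL h0); split=> [x|j l x ji|j l x lk] /=.
- by rewrite /h !eqmap_id.
- by rewrite /h (@eqmap_neq _ _ j) ?linear0.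
- by rewrite /h eqmap_neq //; apply: nesym.
Qed.

Hypothesis Jinj : forall k, k < b -> injective_module (J k).
(** In other words, Hom(H^i(X), J^k) = 0 whenever i + n = k < b. *)
Hypothesis Jkill : forall i k, i + n = k -> k < b ->
  forall g : {linear X i -> J k}, (forall j x, g (diff X j i x) = 0) ->
  forall x, cocycle x -> g x = 0.

(* The lowest component f^i : X^i -> J^k kills coboundaries, hence cocycles by
   Jkill, so it factors through the differential of X; by injectivity of J^k the
   factor extends to X^(i+1), and this extension is the homotopy removing f^i. *)
Lemma clear_component (f : hom X J n) k : k < b -> vanish_below k f ->
  vanish_below b (diff (homc X J) n (n + 1) f) ->
  exists h : hom X J (n - 1),
    vanish_below (k + 1) (f - diff (homc X J) (n - 1) n h).
Proof.
move=> kb fk dfb; have [i ik] : exists i, i + n = k by exists (k - n); lia.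
have f_bd j x : f i k (diff X j i x) = 0.
  have [ji|/eqP ji] := eqVneq (j + 1) i; last by rewrite diff_neq // linear0.
  have := dfb j k x kb; rewrite (hom_diffE _ _ _ (subrK 1 k) ji) // fk; last lia.
  rewrite linear0 sub0r => /eqP; rewrite oppr_eq0 => /eqP /(congr1 ( *:%R (sgn R n))).
  by rewrite scalerA sgnMs scale1r scaler0.
have f_cyc x : diff X i (i + 1) x = 0 -> f i k x = 0.
  by move=> /cocycleP; apply: Jkill.
have [g gE] := injective_extend (Jinj kb) f_cyc.
(* The differential of a hom h of degree n - 1 contains -(-1)^(n-1) h d = (-1)^n h d, so the factor
   (-1)^n turns this term into g d = f^i. *)
have sgL : linear (fun x => sgn R n *: g x).
  by move=> a x y; rewrite linearP scalerDr !scalerA mulrC.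
have [h [hE h1 h2]] := elementary_hom (lin_of sgL) ik.
exists h => j l x lk; have n1 : n - 1 + 1 = n by rewrite subrK.
have fE : (f - diff (homc X J) (n - 1) n h) j l x
    = f j l x - diff (homc X J) (n - 1) n h j l x.
  by rewrite /= scaleN1r.
rewrite fE (hom_diffE _ _ n1 (subrK 1 l) erefl) h2 ?linear0; last lia.
rewrite sub0r opprK.
have sn : sgn R (n - 1) = - sgn R n by rewrite -[in RHS](subrK 1 n) sgnS opprK.
have [lk'|/eqP lk'] := eqVneq l k; last first.
  by rewrite h2 // fk ?scaler0 ?addr0 //; lia.
subst l; have [e|/eqP e] := eqVneq j i; last first.
  rewrite hfun_neq; last by lia.
  by rewrite h1 ?scaler0 ?addr0 //; lia.
by subst j; rewrite hE /= gE scalerA sn mulNr sgnMs scaleN1r subrr.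
Qed.

(** As J vanishes below a, finitely many uses of [clear_component] suffice. The homotopies add up,
    and subtracting a coboundary does not change the differential of f. *)
Lemma clear_below a (f : hom X J n) : (forall k (y : J k), k < a -> y = 0) ->
  vanish_below b (diff (homc X J) n (n + 1) f) ->
  exists h : hom X J (n - 1), vanish_below b (f - diff (homc X J) (n - 1) n h).
Proof.
move=> Ja dfb.
have main t : a + Posz t <= b ->
    exists h : hom X J (n - 1),
      vanish_below (a + Posz t) (f - diff (homc X J) (n - 1) n h).
  elim: t => [|t IH] tb.
    by exists 0 => i j x ja; apply: Ja; lia.
  have [|h hv] := IH; first by lia.
  set f' := f - _ in hv.
  have [||h' h'v] := @clear_component f' (a + Posz t) _ hv; first by lia.
    by move=> i j x jb; rewrite linearB diff_diff subr0 dfb.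
  exists (h + h') => i j x jt.
  by rewrite linearD opprD addrA; apply: h'v; lia.
have [ab|ba] := lerP a b; last by exists 0 => i j x jb; apply: Ja; lia.
have [|h hv] := main `|b - a|%N; first by lia.
by exists h => i j x jb; apply: hv; lia.
Qed.

End ClearComponents.

Definition k_injective J := forall A, acyclic A -> acyclic (homc A J).

(** Cocycles of an acyclic complex are coboundaries, so the killing condition of [clear_below] holds
    by itself; clearing up to b + 1 removes every component. *)
Lemma bounded_injective_k_injective J a b :
  (forall k, injective_module (J k)) ->
  (forall k (y : J k), (k < a) || (b < k) -> y = 0) -> k_injective J.
Proof.
move=> Jinj Jab A /acyclicP aA; apply/acyclicP => n f cf.
have [||||h hv] := @clear_below A J n (b + 1) _ _ a f.
- by [].
- by move=> i k _ _ g g0 x /aA [j [y ->]].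
- by move=> k y ka; apply: Jab; rewrite ka.
- by move=> i j x _; rewrite cf.
exists (n - 1), h; apply/eqP; rewrite -subr_eq0; apply/eqP; apply: homP => i j x.
have [jb|jb] := ltP j (b + 1); first exact: hv.
by apply: Jab; apply/orP; right; lia.
Qed.

End HomComplexes.

(** * Mapping cones *)

Section Cones.
Variable R : comNzRingType.
Implicit Types A B C D J P X Y : complex R.

Section Cone.
Variables (A B : complex R) (e : chain_map A B).

Definition cone_obj (i : int) : lmodType R := (B i * A (i + 1)%R)%type.

(** The second coordinate lives in A^(i+1); [eqmap] carries it to A^j if j = i + 1 and to zero
    otherwise, as [diff_neq] demands. *)
Definition cone_diff_fun i j (x : cone_obj i) : cone_obj j :=
  (diff B i j x.1 + e j (eqmap A (i + 1) j x.2), - diff A (i + 1) (j + 1) x.2).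

Fact cone_diff_linear i j : linear (@cone_diff_fun i j).
Proof.
move=> a x y; rewrite /cone_diff_fun /= !linearP.
by congr pair; rewrite /= ?scalerDr ?scalerN ?opprD // addrACA.
Qed.

Definition cone_diff i j : {linear cone_obj i -> cone_obj j} :=
  lin_of (@cone_diff_linear i j).

Fact cone_diff_neq i j x : i + 1 <> j -> cone_diff i j x = 0.
Proof.
move=> ij; congr pair; rewrite /= diff_neq ?oppr0 //; last by lia.
by rewrite eqmap_neq // linear0 addr0.
Qed.

Fact cone_diff_diff i j k x : cone_diff j k (cone_diff i j x) = 0.
Proof.
congr pair; rewrite /= ?linearN ?linearD /= diff_diff ?oppr0 // add0r.
rewrite -cmap_diff; have [ij|/eqP ij] := eqVneq (i + 1) j.
  have [jk|/eqP jk] := eqVneq (j + 1) k.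
    subst k j; rewrite !eqmap_id.
    by rewrite subrr.
  by rewrite (diff_neq _ jk) (eqmap_neq _ jk) !linear0 addr0.
have ij' : i + 1 + 1 <> j + 1 by lia.
by rewrite (eqmap_neq _ ij) (diff_neq _ ij') !linear0 addr0.
Qed.

Definition cone : complex R :=
  @Complex R cone_obj cone_diff cone_diff_neq cone_diff_diff.


(** The long exact sequence on elements. From acyclicity: if e x = d b, then (-b, x) is a cocycle of
    the cone and its primitive bounds x up to sign; a cocycle y of B gives (y, 0). Conversely, for a
    cocycle (b, a), injectivity gives a = d a1, and surjectivity is applied to b + e a1. *)
Lemma acyclic_cone : acyclic cone <-> quasi_iso e.
Proof.
rewrite acyclicP quasi_isoP; split=> [aC n|qe n [b a] c].
  split=> [x cx|y cy].
    have [k kn] : exists k, k + 1 = n by exists (n - 1); rewrite subrK.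
    subst n => /(@coboundaryP _ _ _ _ k erefl)[b eb].
    have [|z /(congr1 snd) /= xz] := @coboundaryP _ cone k (- b, x) (k - 1) (subrK 1 k).
      apply: aC; apply/cocycleP; congr pair; rewrite /= ?cx ?oppr0 //.
      by rewrite linearN -eb eqmap_id addNr.
    by rewrite xz; apply/coboundaryN/coboundary_diff.
  have [|z yz] := @coboundaryP _ cone n (y, 0) (n - 1) (subrK 1 n).
    apply: aC => j; congr pair; rewrite /= ?cy ?linear0 ?oppr0 //.
    by rewrite addr0.
  move: yz => /pair_equal_spec /= [y1 y2].
  exists (eqmap A (n - 1 + 1) n z.2).
    move=> j; apply/eqP; rewrite -oppr_eq0; apply/eqP.
    have [nj|/eqP nj] := eqVneq (n + 1) j; last by rewrite diff_neq ?oppr0.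
    subst j; rewrite [RHS]y2; congr (- _).
    by move: (z.2); rewrite subrK => u; rewrite eqmap_id.
  by rewrite y1 opprD addrCA subrr addr0 -linearN; apply: coboundary_diff.
have da : cocycle a.
  apply/cocycleP; have := congr1 snd (c (n + 1)) => /= /eqP.
  by rewrite oppr_eq0 => /eqP.
have db : diff B n (n + 1) b + e (n + 1) a = 0.
  by have := congr1 fst (c (n + 1)); rewrite /= eqmap_id.
have [ei _] := qe (n + 1); have [_ es] := qe n.
have [|a1 aE] := coboundaryP (erefl (n + 1)) (ei a da _).
  have -> : e (n + 1) a = - diff B n (n + 1) b.
    by apply/eqP; rewrite -addr_eq0 [X in X == _]addrC db.
  exact/coboundaryN/coboundary_diff.
have [|x cx] := es (b + e n a1).
  by apply/cocycleP; rewrite linearD -cmap_diff -aE.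
move=> /coboundary_pred_diff[y yE]; have [k kn] : exists k, k + 1 = n.
  by exists (n - 1); rewrite subrK.
subst n; have kk : k + 1 - 1 = k by lia.
move: y yE; rewrite kk => y yE.
exists k, (- y, x - a1); congr pair => /=.
  by rewrite eqmap_id linearB linearN -yE opprB addrA subrK addrK.
by rewrite linearB cx sub0r opprK.
Qed.

End Cone.

Section HomCone.
Variables (X A B : complex R) (e : chain_map A B).

Definition hom_cone_hom n (p : cone (post_map X e) n) : hom X (cone e) n.
Proof.
exists (fun i j x => (p.1 i j x, p.2 i (j + 1) x)) => [i j|i j x ij].
  by move=> a x y; rewrite !linearP.
by rewrite !hfun_neq //; lia.
Defined.

Fact hom_cone_linear n : linear (@hom_cone_hom n).
Proof. by move=> a x y; apply: homP. Qed.

Lemma eqmap_hom m n (f : hom X A m) i j x : m = n ->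
  eqmap (homc X A) m n f i j x = f i j x.
Proof. by move=> mn; subst n; rewrite eqmap_id. Qed.

Lemma eqmap_homr m (f : hom X A m) i j k x : j = k ->
  eqmap A j k (f i j x) = f i k x.
Proof. by move=> jk; subst k; rewrite eqmap_id. Qed.

Definition hom_cone : chain_map (cone (post_map X e)) (homc X (cone e)).
Proof.
exists (fun n => lin_of (@hom_cone_linear n)) => m n p.
have [mn|/eqP mn] := eqVneq (m + 1) n; last first.
  by rewrite !diff_neq // linear0.
apply: homP => i j x; rewrite (hom_diffE _ _ mn (subrK 1 j) erefl).
have dE := hom_diffE _ _ mn (subrK 1 j) (erefl (i + 1)).
have mn' : m + 1 + 1 = n + 1 by rewrite mn.
have dE' := hom_diffE p.2 x mn' (erefl (j + 1)) (erefl (i + 1)).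
congr pair; rewrite /= -/(homc _ _).
  rewrite -[X in X + _ = _]/(diff (homc X B) m n p.1 i j x) dE.
  by rewrite eqmap_hom // eqmap_homr ?subrK // addrAC.
rewrite -[X in _ *: X = _]/(diff (homc X A) (m + 1) (n + 1) p.2 i (j + 1) x) dE'.
rewrite scaleN1r opprB sgnS scaleNr.
have -> : j - 1 + 1 = j by rewrite subrK.
exact: addrC.
Defined.

(** [hom_cone] is bijective in each degree: Hom(X, -) commutes with cones. *)
Lemma acyclic_hom_cone :
  acyclic (homc X (cone e)) <-> quasi_iso (post_map X e).
Proof.
rewrite -acyclic_cone; symmetry; apply: (acyclic_bijective (f := hom_cone)).
  move=> n p q /(congr1 (fun h : hom _ _ _ => h : forall i j, _)) pq.
  have pqE i j x := congr1 (fun h : forall i j, _ => h i j x) pq.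
  rewrite [p]surjective_pairing [q]surjective_pairing; congr pair.
    by apply: homP => i j x; have [] := pqE i j x.
  apply: homP => i j x; have [k kj] : exists k, k + 1 = j.
    by exists (j - 1); rewrite subrK.
  by subst j; have [] := pqE i k x.
move=> n h.
have h1L i j : linear (fun x => (h i j x).1).
  by move=> a x y; rewrite linearP.
have h1n i j (x : X i) : i + n <> j -> (h i j x).1 = 0.
  by move=> ij; rewrite hfun_neq.
have h2L i j : linear (fun x => eqmap A (j - 1 + 1) j (h i (j - 1) x).2).
  by move=> a x y; rewrite !linearP.
have h2n i j x : i + (n + 1) <> j ->
    eqmap A (j - 1 + 1) j (h i (j - 1) x).2 = 0.
  by move=> ij; rewrite hfun_neq ?linear0 //; lia.
exists (Hom h1L h1n, Hom h2L h2n); apply: homP => i j x /=.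
rewrite [RHS]surjective_pairing; congr pair.
have -> : j + 1 - 1 = j by lia.
by rewrite eqmap_id.
Qed.

End HomCone.

Lemma k_projective_post_map P A B (e : chain_map A B) :
  (forall C, acyclic C -> acyclic (homc P C)) ->
  quasi_iso e -> quasi_iso (post_map P e).
Proof. by move=> kP /acyclic_cone /kP /acyclic_hom_cone. Qed.

Section Composition.
Variables (X A B : complex R) (m n : int) (g : hom A B m) (f : hom X A n).

Definition hom_comp : hom X B (n + m).
Proof.
exists (fun i j x => g (i + n) j (f i (i + n) x)) => [i j|i j x ij].
  by move=> a x y; rewrite !linearP.
by rewrite hfun_neq //; lia.
Defined.

End Composition.

Lemma hom_compE X A B m n (g : hom A B m) (f : hom X A n) i j k x :
  i + n = k -> hom_comp g f i j x = g k j (f i k x).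
Proof. by move=> <-. Qed.

(** The Leibniz rule d(g f) = (d g) f + (-1)^m g (d f), with d f = 0. *)
Lemma hom_comp_diff X A B m n k l (g : hom A B m) (f : hom X A n) i j x :
  n + m + 1 = k -> m + 1 = l -> cocycle (f : homc X A n) ->
  diff (homc X B) (n + m) k (hom_comp g f) i j x
    = hom_comp (diff (homc A B) m l g : hom A B l) f i j x.
Proof.
move=> mk ml cf; rewrite (hom_diffE _ _ mk (subrK 1 j) erefl).
rewrite [RHS](hom_compE _ _ _ _ erefl) (hom_diffE _ _ ml (subrK 1 j) erefl).
congr (_ - _).
have := congr1 (fun h : hom _ _ _ => h i (i + 1 + n) x) (cf (n + 1)).
have e1 : i + n + 1 = i + 1 + n by lia.
rewrite /= -[X in X = 0]/(diff (homc X A) n (n + 1) f i (i + 1 + n) x).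
rewrite (hom_diffE _ _ erefl e1 erefl) => /eqP; rewrite subr_eq0 => /eqP fd.
rewrite -(hom_compE g f _ _ (erefl (i + 1 + n))).
rewrite -sgnM mulrC -scalerA; congr (_ *: _).
by rewrite /= -linearZ -fd; move: e1 => /esym e1; rewrite e1.
Qed.

(* The cone is contractible: a homotopy s with ds = id turns every cocycle F
   of Hom(X, cone e) into d(s F). *)
Lemma k_injective_post_map A B (e : chain_map A B) X :
  k_injective A -> k_injective B -> quasi_iso e -> quasi_iso (post_map X e).
Proof.
move=> kA kB qe; apply/acyclic_hom_cone.
have aC : acyclic (cone e) by apply/acyclic_cone.
have /acyclicP aCC : acyclic (homc (cone e) (cone e)).
  apply/acyclic_hom_cone/quasi_isoP => n.
  (* Hom(cone e, A) and Hom(cone e, B) are both acyclic, so any map between them is a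
     quasi-isomorphism. *)
  have /acyclicP a1 := kA _ aC; have /acyclicP a2 := kB _ aC.
  split=> [x cx _|y cy]; first exact: a1.
  exists 0; first by move=> j; rewrite linear0.
  by rewrite linear0 sub0r; apply/coboundaryN/a2.
have /coboundary_pred_diff[s sE] : coboundary (hom_id (cone e) : homc _ _ 0).
  apply: aCC => j.
  have := homothety0_diff (cone e) j 1; rewrite [homothety0 _ _]scale1r. exact.
apply/acyclicP => n f cf.
exists (n + (0 - 1)), (hom_comp s f); apply: homP => i j x.
have e1 : n + (0 - 1) + 1 = n by lia.
rewrite (@hom_comp_diff _ _ _ _ _ _ 0 _ _ _ _ _ e1) ?subrK // -sE /=.
have [e2|/eqP e2] := eqVneq (i + n) j; last by rewrite eqmap_neq // hfun_neq.
by subst j; rewrite eqmap_id.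
Qed.

End Cones.

(** * Comparison of semi-projective resolutions *)

Section ResolutionComparison.
Variable R : comNzRingType.
Implicit Types A B C D P Q X Y : complex R.

Fact hom_of_map_linear A B (u : chain_map A B) i j :
  linear (fun x => eqmap B i j (u i x)).
Proof. by move=> a x y; rewrite !linearP. Qed.

Fact hom_of_map_neq A B (u : chain_map A B) i j x :
  i + 0 <> j -> eqmap B i j (u i x) = 0.
Proof. by rewrite addr0 => ij; rewrite eqmap_neq. Qed.

Definition hom_of_map A B (u : chain_map A B) : hom A B 0 :=
  Hom (hom_of_map_linear u) (@hom_of_map_neq A B u).

Lemma hom_of_map_cocycle A B (u : chain_map A B) :
  cocycle (hom_of_map u : homc A B 0).
Proof.
apply/cocycleP; apply: homP => i j x.
rewrite (hom_diffE _ _ (add0r 1) (subrK 1 j) erefl) /= scale1r cmap_diff.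
have [ij|/eqP ij] := eqVneq (i + 1) j.
  by subst j; rewrite addrK !eqmap_id subrr.
have ij' : i <> j - 1 by lia.
by rewrite (eqmap_neq _ ij) (eqmap_neq _ ij') linear0 subrr.
Qed.

Lemma map_of_cocycle A B (f : hom A B 0) : cocycle (f : homc A B 0) ->
  exists u : chain_map A B, hom_of_map u = f.
Proof.
move=> cf; pose u i := lin_of (@hfun_linear _ _ _ _ f i i).
have uD i j x : u j (diff A i j x) = diff B i j (u i x).
  have [ij|/eqP ij] := eqVneq (i + 1) j; last by rewrite !diff_neq // linear0.
  subst j; have := congr1 (fun h : hom _ _ _ => h i (i + 1) x) (cf 1).
  rewrite /= -[X in X = 0]/(diff (homc A B) 0 1 f i (i + 1) x).
  rewrite (hom_diffE _ _ (add0r 1) (erefl (i + 1)) erefl) scale1r => /eqP.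
  by rewrite subr_eq0 => /eqP <-.
exists (ChainMap uD); apply: homP => i j x /=.
have [ij|/eqP ij] := eqVneq i j; first by subst j; rewrite eqmap_id.
by rewrite eqmap_neq // hfun_neq // addr0.
Qed.

Lemma homotopyP A B (u v : chain_map A B) :
  coboundary (hom_of_map u - hom_of_map v : homc A B 0) ->
  exists h : forall i j, {linear A i -> B j}, forall i x,
    u i x - v i x = diff B (i - 1) i (h i (i - 1) x)
                    + h (i + 1) i (diff A i (i + 1) x).
Proof.
move=> /(@coboundaryP _ _ _ _ (- 1) (addNr 1))[h hE].
exists (fun i j => lin_of (@hfun_linear _ _ _ _ h i j)) => i x.
have := congr1 (fun h : hom _ _ _ => h i i x) hE.
rewrite (hom_diffE _ _ (addNr 1) (subrK 1 i) erefl) /= !eqmap_id scaleN1r => ->.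
by rewrite scaleN1r opprK.
Qed.

(** Each resolution map lifts, up to homotopy, through the other one. After composition with [eP],
    the maps g f and id become homotopic, and [eP] induces an injection on the homotopy classes of
    maps from P. *)
Lemma semi_projective_comparison Y (P Q : semi_projective_resolution Y) :
  exists (f : chain_map (proj_res P) (proj_res Q))
         (g : chain_map (proj_res Q) (proj_res P))
         (h : forall i j, {linear proj_res P i -> proj_res P j}),
    forall i x, g i (f i x) - x = diff (proj_res P) (i - 1) i (h i (i - 1) x)
                    + h (i + 1) i (diff (proj_res P) i (i + 1) x).
Proof.
case: P Q => P eP [iP kP] qP [Q eQ [iQ kQ] qQ] /=; clear iP iQ.
have /quasi_isoP/(_ 0)[_ liftPQ] := k_projective_post_map kP qQ.
have /quasi_isoP/(_ 0)[_ liftQP] := k_projective_post_map kQ qP.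
have /quasi_isoP/(_ 0)[injPP _] := k_projective_post_map kP qP.
have [f' cf'] := liftPQ _ (hom_of_map_cocycle eP).
have [g' cg'] := liftQP _ (hom_of_map_cocycle eQ).
have [f <-] := map_of_cocycle cf'; have [g <-] := map_of_cocycle cg'.
move=> /(@coboundaryP _ _ _ _ (- 1) (addNr 1))[k kE] bf.
have idD i j x : id_map (P j) (diff P i j x) = diff P i j (id_map (P i) x).
  by [].
have [|h hE] := @homotopyP _ _ (comp_map g f) (ChainMap idD).
  apply: injPP.
    by apply: cocycleD; last apply: cocycleN; apply: hom_of_map_cocycle.
  (* With eP g - eQ = d k one has eP (g f - id) = d(k f) + (eQ f - eP), a sum of coboundaries. *)
  pose kf := hom_comp k (hom_of_map f).
  have -> : post_map P eP 0 (hom_of_map (comp_map g f)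
               - hom_of_map (ChainMap idD) : homc P P 0)
      = diff (homc P Y) (0 + - 1) 0 kf
        + (post_map P eQ 0 (hom_of_map f) - hom_of_map eP : homc P Y 0).
    apply: homP => i j x.
    rewrite [RHS]/= -[X in _ = X + _]/(diff (homc P Y) (0 + - 1) 0 kf i j x).
    rewrite (@hom_comp_diff _ _ _ _ _ _ 0 0) //; last exact: hom_of_map_cocycle.
    rewrite (hom_compE _ _ _ _ (addr0 i)) -kE /= !eqmap_id !scaleN1r.
    have [ij|/eqP ij] := eqVneq i j; last first.
      by rewrite !eqmap_neq // !subr0 !linear0 addr0.
    by subst j; rewrite !eqmap_id linearB /= addrA subrK.
  by apply: coboundaryD => //; apply: coboundary_diff.
by exists f, g, h.
Qed.

End ResolutionComparison.

(** * Ideals and projective modules *)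

Section Ideals.
Variable R : comNzRingType.
Implicit Types (J K : R -> Prop) (a b : R).

(** Unlike [idealr], this admits the unit ideal, which may occur as J + (a) in the induction. *)
Definition ideal_set J :=
  [/\ J 0, forall a b, J a -> J b -> J (a + b) & forall a b, J b -> J (a * b)].

Definition add_principal J a : R -> Prop :=
  fun r => exists2 b, J b & exists c, r = b + a * c.
Definition colon J a : R -> Prop := fun r => J (a * r).

Lemma ideal_set_idealr (I : idealr R) : ideal_set (fun r => r \in I).
Proof.
split; first exact: idealr0; last by move=> a b; apply: idealMr.
by move=> a b; apply: rpredD.
Qed.

Lemma ideal_set_eq0 : ideal_set (fun r => r = 0).
Proof. by split=> // [a b -> ->|a b ->]; rewrite ?addr0 ?mulr0. Qed.

Lemma ideal_set_colon J a : ideal_set J -> ideal_set (colon J a).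
Proof.
move=> [J0 JD JM]; split=> [|b c Jb Jc|b c Jc]; rewrite /colon.
- by rewrite mulr0.
- by rewrite mulrDr; apply: JD.
- by rewrite mulrCA; apply: JM.
Qed.

Lemma ideal_set_add_principal J a : ideal_set J -> ideal_set (add_principal J a).
Proof.
move=> [J0 JD JM]; split=> [|_ _ [b Jb [c ->]] [b' Jb' [c' ->]]|r _ [b Jb [c ->]]].
- by exists 0 => //; exists 0; rewrite mulr0 addr0.
- exists (b + b'); first exact: JD.
  by exists (c + c'); rewrite mulrDr addrACA.
- exists (r * b); first exact: JM.
  by exists (r * c); rewrite mulrDr [r * (a * c)]mulrCA.
Qed.

Lemma idealr_of_set J : ideal_set J -> ~ J 1 ->
  exists I : idealr R, forall r, r \in I <-> J r.
Proof.
move=> [J0 JD JM] J1; pose S : R -> bool := fun r => `[< J r >].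
have SP r : r \in S <-> J r by split=> /asboolP.
have JN a : J a -> J (- a) by rewrite -mulN1r; apply: JM.
have cS : idealr_closed S.
  split; [exact/SP | by apply/negP => /SP|].
  by move=> a b c /SP Jb /SP Jc; apply/SP/JD => //; apply: JM.
pose I : idealr R := HB.pack S (isIdealr.Build R S cS).
by exists I.
Qed.

Lemma prime_of_set J : ideal_set J -> ~ J 1 ->
  (forall a b, J (a * b) -> J a \/ J b) ->
  exists p : prime_idealr R, forall r, r \in p <-> J r.
Proof.
move=> [J0 JD JM] J1 Jp; pose S : R -> bool := fun r => `[< J r >].
have SP r : r \in S <-> J r by split=> /asboolP.
have cS : idealr_closed S.
  split; [exact/SP | by apply/negP => /SP|].
  by move=> a b c /SP Jb /SP Jc; apply/SP/JD => //; apply: JM.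
have pS : prime_idealr_closed S.
  by move=> a b /SP /Jp [] ?; apply/orP; [left|right]; apply/SP.
pose p : prime_idealr R :=
  HB.pack S (isIdealr.Build R S cS) (isPrimeIdealrClosed.Build R S pS).
by exists p.
Qed.

(** A counterexample would start, by dependent choice, a strictly ascending chain of ideals; its
    union is finitely generated, so the chain would stop. *)
Lemma noetherian_induction (Q : (R -> Prop) -> Prop) : noetherian R ->
  (forall J, ideal_set J ->
     (forall K, ideal_set K -> (forall r, J r -> K r) ->
        (exists2 r, K r & ~ J r) -> Q K) -> Q J) ->
  forall J, ideal_set J -> Q J.
Proof.
move=> noethR ind J0 iJ0; apply: contrapT => nQJ0.
pose T := {J | ideal_set J /\ ~ Q J}.
have step (J : T) : exists K : T,
    (forall r, sval J r -> sval K r) /\ exists2 r, sval K r & ~ sval J r.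
  case: J => J [iJ nQJ] /=; apply: contrapT => noK; apply/nQJ/ind => // K iK JK JltK.
  apply: contrapT => nQK; apply: noK.
  by exists (exist _ K (conj iK nQK)).
have [next nextP] := choice step.
pose c n := sval (iter n next (exist _ J0 (conj iJ0 nQJ0) : T)).
have c_ideal n : ideal_set (c n) by rewrite /c; case: (iter _ _ _) => ? [].
have cS n r : c n r -> c n.+1 r by exact: (nextP _).1.
have c_mono n k r : c n r -> c (n + k)%N r.
  by elim: k => [|k IH]; rewrite ?addn0 // addnS => /IH /cS.
have c_strict n : exists2 r, c n.+1 r & ~ c n r by exact: (nextP _).2.
have U_ideal : ideal_set (fun r => exists n, c n r).
  split; first by exists 0%N; have [] := c_ideal 0%N.
    move=> a b [n cn] [k ck]; exists (n + k)%N; have [_ cD _] := c_ideal (n + k)%N.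
    by apply: cD; [exact: c_mono|rewrite addnC; exact: c_mono].
  by move=> a b [n cn]; exists n; have [_ _ cM] := c_ideal n; apply: cM.
suff [N cN] : exists N, forall r, (exists n, c n r) -> c N r.
  by have [r cr ncr] := c_strict N; apply/ncr/cN; exists N.+1.
(* The union is an [idealr] only if it is proper; if 1 lies in some member, that member is already
   everything. *)
case: (pselect (exists n, c n 1)) => [[N cN1]|U1].
  exists N => r _; rewrite -[r]mulr1.
  by have [_ _ cM] := c_ideal N; apply: cM.
have [I IP] := idealr_of_set U_ideal U1.
have [n [g gP]] := noethR I.
have [N NP] : exists N, forall i, c N (val (g i)).
  have gU i : exists n, c n (val (g i)) by apply/IP; exact: (valP (g i)).
  have [h hP] := choice gU; exists (\sum_i h i)%N => i.
  by rewrite (bigD1 i) //=; apply: c_mono.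
have [c0 cD cM] := c_ideal N.
exists N => r /IP rI; have [e rE] := gP (Subm (rI : r \in ideal_pred I)).
rewrite -[r]/(subm_val (Subm (rI : r \in ideal_pred I))) rE.
elim/big_ind: _ => [|x y|i _] //; first exact: cD.
exact/cM/NP.
Qed.

End Ideals.

Section ProjectiveModules.
Variables (R : comNzRingType) (P : lmodType R).
Implicit Types (M N : lmodType R) (J : R -> Prop) (a : R).

(* For projective P this is the submodule JP. *)
Definition ideal_mult (M : lmodType R) J (x : M) :=
  forall phi : {linear M -> R^o}, J (phi x).

Lemma ideal_multD M J (x y : M) : ideal_set J ->
  ideal_mult J x -> ideal_mult J y -> ideal_mult J (x + y).
Proof. by move=> [_ JD _] Jx Jy phi; rewrite linearD; apply: JD. Qed.

Lemma ideal_multZ M J a (x : M) : ideal_set J ->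
  ideal_mult J x -> ideal_mult J (a *: x).
Proof. by move=> [_ _ JM] Jx phi; rewrite linearZ; apply: JM. Qed.

Lemma ideal_multB M J (x y : M) : ideal_set J ->
  ideal_mult J x -> ideal_mult J y -> ideal_mult J (x - y).
Proof.
by move=> iJ Jx Jy; rewrite -scaleN1r; apply: ideal_multD => //; apply: ideal_multZ.
Qed.

Lemma ideal_mult0 M J : ideal_set J -> ideal_mult J (0 : M).
Proof. by move=> [J0 _ _] phi; rewrite linear0. Qed.

Lemma ideal_mult_linear M N J (f : {linear M -> N}) x :
  ideal_mult J x -> ideal_mult J (f x).
Proof. by move=> Jx phi; exact: (Jx (lin_of (linearP (phi \o f)))). Qed.

Lemma ideal_mult_colon M J a (x : M) :
  ideal_mult J (a *: x) <-> ideal_mult (colon J a) x.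
Proof. by split=> Jx phi; have := Jx phi; rewrite linearZ. Qed.

Hypothesis projP : projective_module P.

Definition delta (y : P) : P -> R^o := fun z => (z == y)%:R.

Definition span_pred : {pred ((P -> R^o) * P)%type} := fun v =>
  `[< exists s : seq (R * P),
        v = \sum_(t <- s) t.1 *: (delta t.2, t.2) >].

Fact span_closed : subsemimod_closed span_pred.
Proof.
split; first split.
- by apply/asboolP; exists [::]; rewrite big_nil.
- move=> _ _ /asboolP[s ->] /asboolP[t ->]; apply/asboolP.
  by exists (s ++ t); rewrite big_cat.
- move=> a _ /asboolP[s ->]; apply/asboolP.
  exists [seq (a * t.1, t.2) | t <- s]; rewrite big_map scaler_sumr.
  by apply: eq_bigr => t _; rewrite scalerA.
Qed.
HB.instance Definition _ :=
  GRing.isSubmodClosed.Build R ((P -> R^o) * P)%type span_pred span_closed.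

(* The span of the pairs (delta y, y) plays the role of the free module on P;
   a section of its second projection gives the coordinates. *)
Lemma dual_basis : exists phi : P -> {linear P -> R^o},
  forall x, exists s : seq P, x = \sum_(y <- s) phi y x *: y.
Proof.
have qL : linear (fun v : subm span_pred => (val v).2) by move=> a x y.
have [|g gE] := @projP _ _ (lin_of qL) (id_map P).
  move=> y; have yS : (delta y, y) \in span_pred.
    by apply/asboolP; exists [:: (1, y)]; rewrite big_seq1 scale1r.
  by exists (Subm yS).
have phiL y : linear (fun x => (val (g x)).1 y : R^o).
  move=> a x z; have -> : g (a *: x + z) = a *: g x + g z by exact: linearP.
  have -> : val (a *: g x + g z) = a *: val (g x) + val (g z).
    by rewrite linearD linearZ.
  by case: (val (g x)) => u v; case: (val (g z)) => u' v'.
exists (fun y => lin_of (phiL y)) => x.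
have /asboolP[s sE] := valP (g x).
(* The coordinate at y collects the coefficients of all pairs over y, so each y may be listed only
   once. *)
exists (undup [seq t.2 | t <- s]).
have xE : x = \sum_(t <- s) t.1 *: t.2.
  rewrite -[LHS](gE x) /= sE.
  by elim: s {sE} => [|t s IH]; rewrite ?big_nil // !big_cons -IH.
have phiE y : (val (g x)).1 y = \sum_(t <- s) t.1 * (y == t.2)%:R.
  rewrite sE; elim: s {sE xE} => [|t s IH]; rewrite ?big_nil // !big_cons -IH.
  by [].
rewrite [LHS]xE; under [RHS]eq_bigr do rewrite /= phiE scaler_suml.
rewrite exchange_big /=; apply: eq_big_seq => t ts.
rewrite (bigD1_seq t.2) ?undup_uniq ?mem_undup ?map_f //= eqxx mulr1.
by rewrite big1 ?addr0 // => y /negPf ->; rewrite mulr0 scale0r.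
Qed.

Lemma ideal_mult_eq0 (x : P) : ideal_mult (fun r => r = 0) x -> x = 0.
Proof.
have [phi phiP] := dual_basis; have [s xE] := phiP x => x0.
by rewrite xE big1 // => y _; rewrite x0 scale0r.
Qed.

(** Splitting each coordinate of x as b + a c shows (J + (a))P = JP + aP. *)
Lemma ideal_mult_add_principal J a (x : P) : ideal_set J ->
  ideal_mult (add_principal J a) x ->
  exists y u, ideal_mult J y /\ x = y + a *: u.
Proof.
move=> iJ Jx; have [phi phiP] := dual_basis; have [s xE] := phiP x.
have [_ _ JM] := iJ.
rewrite xE; elim: s {xE} => [|z s [y [u [Jy E]]]].
  by exists 0, 0; rewrite big_nil scaler0 addr0; split=> //; apply: ideal_mult0.
rewrite big_cons E; have [b Jb [c ->]] := Jx (phi z).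
exists (b *: z + y), (c *: z + u); split.
  apply: ideal_multD => // psi; rewrite linearZ /= [_ *: _]mulrC.
  exact: JM.
by rewrite scalerDl scalerDr scalerA addrACA.
Qed.

Lemma ideal_mult_sum J (x : P) : ideal_mult J x ->
  exists s : seq (R * P),
    (forall t, t \in s -> J t.1) /\ x = \sum_(t <- s) t.1 *: t.2.
Proof.
move=> Jx; have [phi phiP] := dual_basis; have [s xE] := phiP x.
exists [seq (phi y x : R, y) | y <- s]; split=> [t /mapP[y _ ->]|]; first exact: Jx.
by rewrite big_map.
Qed.

End ProjectiveModules.

(** * Small support *)

Section ResidueField.
Variables (R : comNzRingType) (q : prime_idealr R).

Definition residue1 : residue_field q := cls (@loc_max R q) (frac (1 : R^o) (denom1 q)).

Lemma residue_scale1 r : r *: residue1 = cls (@loc_max R q) (frac (r : R^o) (denom1 q)).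
Proof.
rewrite [LHS]qscale_cls; congr cls; rewrite [LHS]loc_scale_frac; congr frac.
exact: mulr1.
Qed.

Lemma residue_eq0 r : r *: residue1 = 0 <-> r \in q.
Proof.
rewrite residue_scale1 -(cls0 (@loc_max R q)); split=> [/cls_eqP|qr]; last first.
  apply/cls_eqP; rewrite subr0; apply/asboolP.
  by exists r, (denom1 q).
rewrite subr0 => /asboolP[b [s [qb /frac_eqP[u]]]].
rewrite denomE scale1r => E.
have : val u * (val s * r) \in q by rewrite [_ * _]E; apply: idealMr.
by rewrite !prime_idealrM (negPf (valP u)) (negPf (valP s)).
Qed.

Lemma residue_denominator (c : residue_field q) :
  exists2 a, a \notin q & exists b, a *: c = b *: residue1.
Proof.
rewrite -(cls_repr c) -(frac_num_den (repr c)).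
set x := num _; set s := den _; exists (val s); first exact: valP s.
exists x; rewrite residue_scale1 [LHS]qscale_cls; congr cls.
rewrite [LHS]loc_scale_frac; apply/frac_eqP; exists (denom1 q).
by rewrite !denomE !scale1r.
Qed.

Lemma common_denominator (T : Type) (s : seq (T * residue_field q)) :
  exists2 a, a \notin q & exists b : seq (T * R),
    [seq (t.1, a *: t.2) | t <- s] = [seq (t.1, t.2 *: residue1) | t <- b].
Proof.
elim: s => [|[x c] s [a qa [b ab]]].
  by exists 1; [rewrite idealr1 | exists [::]].
have [a' qa' [b' ab']] := residue_denominator c.
exists (a * a'); first by rewrite prime_idealrM negb_or qa.
exists ((x, a * b') :: [seq (t.1, a' * t.2) | t <- b]) => /=; congr cons.
  by rewrite -!scalerA ab'.
rewrite -map_comp.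
have := congr1 (map (fun t => (t.1, a' *: t.2))) ab.
rewrite -!map_comp => E; rewrite -[RHS]/(map _ b).
transitivity [seq (t.1, a' *: (a *: t.2)) | t <- s].
  by apply: eq_map => t /=; rewrite scalerA mulrC.
by rewrite [LHS]E; apply: eq_map => t /=; rewrite scalerA.
Qed.

(* H(P/qP)_q = 0. *)
Definition generically_exact (P : complex R) :=
  forall i (z : P i), (forall j, ideal_mult (fun r => r \in q) (diff P i j z)) ->
  exists2 a, a \notin q & exists2 b : P i, coboundary b &
    ideal_mult (fun r => r \in q) (a *: z - b).

(** This is phi (x) 1, through which equations in P (x) k(q) are read off coordinatewise. *)
Lemma bilin_functional (M : lmodType R) (phi : {linear M -> R^o}) :
  bilin (fun (x : M) (c : residue_field q) => (phi x : R) *: c).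
Proof.
split=> [c a x y|x a c d]; first by rewrite linearP scalerDl scalerA.
by rewrite scalerDr !scalerA mulrC.
Qed.

(** Since d z lies in qP, z (x) 1 is a cocycle, hence bounds. A common denominator a brings the
    bounding element to the form w (x) 1, and applying every phi (x) 1 puts a z - d w into qP. *)
Lemma acyclic_tensor_generically_exact (P : complex R) :
  (forall i, projective_module (P i)) ->
  acyclic (tensc P (residue_field q)) -> generically_exact P.
Proof.
move=> projP /acyclicP aP i z dz; pose N := residue_field q.
have tdE j k (s : seq (P j * N)) : diff (tensc P N) j k (tcls s : tensor (P j) N)
    = tcls (tmap_seq (diff P j k) s) by exact: tmap_cls.
have [|j [w zw]] := aP i (tcls [:: (z, residue1)] : tensor (P i) N).
  move=> j; rewrite tdE; apply/tcls_eqP => L B bB.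
  rewrite /teval big_seq1 big_nil /=.
  (* Write d z as a sum of terms r x with r in q; then r x (x) 1 = x (x) r = 0 in P (x) k(q). *)
  have [s [sq ->]] := ideal_mult_sum (projP j) (dz j).
  have [Bl Br] := bB.
  have B0 x : B 0 x = 0.
    by have := Bl x (-1) 0 0; rewrite /= scaler0 addr0 scaleN1r addNr.
  have B0r x : B x 0 = 0.
    by have := Br x (-1) 0 0; rewrite /= scaler0 addr0 scaleN1r addNr.
  elim: s sq => [|[r x] s IH] sq; first by rewrite big_nil.
  rewrite big_cons [LHS]Bl IH ?addr0 => [|t ts]; last first.
    by apply: sq; rewrite inE ts orbT.
  have /residue_eq0 r0 : r \in q by apply: (sq (r, x)); rewrite inE eqxx.
  have := Br x r residue1 0; rewrite /= r0 B0r !addr0 => <-.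
  by rewrite B0r.
rewrite -(tcls_repr w) tdE in zw; move: (repr w) zw => {w} s zw.
have [a qa [b ab]] := common_denominator s.
exists a => //; exists (diff P j i (\sum_(t <- b) t.2 *: t.1)).
  exact: coboundary_diff.
move=> phi; apply/residue_eq0; rewrite linearB scalerBl linearZ /=.
have := (tcls_eqP _ _).1 zw N _ (bilin_functional phi).
rewrite /teval big_seq1 big_map /= => E.
rewrite -[a *: phi z]/(a * phi z) -scalerA [phi z *: _]E scaler_sumr.
apply/eqP; rewrite subr_eq0; apply/eqP.
pose F (t : P j * N) := (phi (diff P j i t.1) : R) *: t.2.
transitivity (\sum_(t <- [seq (t.1, a *: t.2) | t <- s]) F t).
  by rewrite big_map; apply: eq_bigr => t _; rewrite /F /= !scalerA mulrC.
rewrite ab big_map; elim: b {ab} => [|t b IH].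
  by rewrite !big_nil !linear0 scale0r.
rewrite !big_cons !linearD scalerDl -IH; congr (_ + _).
by rewrite !linearZ /F /= scalerA mulrC.
Qed.

(** Linear maps respect [ideal_mult]. Of the two homotopy terms, d h z is a coboundary and h d z
    lies in qP because d z does. *)
Lemma generically_exact_homotopy (P Q : complex R) (f : chain_map P Q)
    (g : chain_map Q P) (h : forall i j, {linear P i -> P j}) :
  (forall i x, g i (f i x) - x = diff P (i - 1) i (h i (i - 1) x)
                    + h (i + 1) i (diff P i (i + 1) x)) ->
  generically_exact Q -> generically_exact P.
Proof.
move=> hE eQ i z dz; have iq := ideal_set_idealr q.
have [|a qa [b [j [w ->]] bE]] := eQ i (f i z).
  by move=> j; rewrite -cmap_diff; apply: ideal_mult_linear.
exists a => //; exists (diff P j i (g j w) - a *: diff P (i - 1) i (h i (i - 1) z)).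
  apply: coboundaryD; first exact: coboundary_diff.
  exact/coboundaryN/coboundaryZ/coboundary_diff.
have -> : a *: z - (diff P j i (g j w) - a *: diff P (i - 1) i (h i (i - 1) z))
    = g i (a *: f i z - diff Q j i w) - a *: h (i + 1) i (diff P i (i + 1) z).
  rewrite [g i _]linearB [g i (_ *: _)]linearZ cmap_diff opprB /=.
  have -> : g i (f i z) = z + (diff P (i - 1) i (h i (i - 1) z)
                              + h (i + 1) i (diff P i (i + 1) z)).
    by rewrite -hE addrC subrK.
  by rewrite !scalerDr !addrA [RHS]addrAC addrK.
apply: ideal_multB => //; first exact: ideal_mult_linear.
by apply: ideal_multZ => //; apply: ideal_mult_linear.
Qed.

End ResidueField.

(** * Local exactness modulo ideals *)

Section LocalExactness.
Variables (R : comNzRingType) (P : complex R) (p : prime_idealr R).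
Hypothesis projP : forall i, projective_module (P i).

(* H(P/JP)_p = 0. *)
Definition locally_exact (J : R -> Prop) :=
  forall i (z : P i), (forall j, ideal_mult J (diff P i j z)) ->
  exists2 s, s \notin p & exists2 b : P i, coboundary b &
    ideal_mult J (s *: z - b).

(* The long exact sequence of 0 -> R/(J:a) -> R/J -> R/(J+a) -> 0, written out
   on elements. *)
Lemma locally_exact_colon J a : ideal_set J ->
  locally_exact (add_principal J a) -> locally_exact (colon J a) ->
  locally_exact J.
Proof.
move=> iJ exD exC i z dz.
have [|s ps [b cb]] := exD i z.
  move=> j phi; exists (phi (diff P i j z)); first exact: dz.
  by exists 0; rewrite mulr0 addr0.
move=> /(ideal_mult_add_principal (@projP i) iJ)[y [u [Jy zE]]].
(* From s z - b = y + a u with y in JP, the element a d u = s d z - d y lies in JP, so u is a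
   cocycle modulo (J : a)P. *)
have [|s' ps' [b' cb' uE]] := exC i u.
  move=> j; apply/ideal_mult_colon.
  have -> : a *: diff P i j u = s *: diff P i j z - diff P i j y.
    have bj : diff P i j b = 0 by case: cb => k [w ->]; rewrite diff_diff.
    have := congr1 (diff P i j) zE.
    rewrite linearB linearD !linearZ /= bj subr0 => ->.
    by rewrite addrC addKr.
  apply: ideal_multB => //; first exact: ideal_multZ.
  exact: ideal_mult_linear.
exists (s' * s); first by rewrite prime_idealrM negb_or ps'.
exists (s' *: b + a *: b'); first by apply: coboundaryD; apply: coboundaryZ.
have -> : (s' * s) *: z - (s' *: b + a *: b') = s' *: y + a *: (s' *: u - b').
  rewrite opprD addrA -scalerA -scalerBr zE scalerDr scalerBr.
  by rewrite !scalerA [s' * a]mulrC addrA.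
apply: ideal_multD => //; first exact: ideal_multZ.
exact/ideal_mult_colon.
Qed.

(* The assumption on q + (a) makes a injective on H(P/qP)_p for every a outside
   q, so that this module embeds into H(P/qP)_q = 0. *)
Lemma locally_exact_prime (q : prime_idealr R) : generically_exact q P ->
  (forall a, a \notin q -> locally_exact (add_principal (fun r => r \in q) a)) ->
  locally_exact (fun r => r \in q).
Proof.
move=> exq exD i z dz; have iq := ideal_set_idealr q.
have [a qa [b /coboundary_pred_diff[w bw] bE]] := exq i z dz.
(* As a z - d w lies in qP, w is a cocycle modulo (q + (a))P. *)
have [|s ps [v cv]] := exD a qa (i - 1) w.
  move=> j phi; have [ij|/eqP ij] := eqVneq (i - 1 + 1) j; last first.
    rewrite diff_neq // linear0; exists 0; first exact: idealr0.
    by exists 0; rewrite mulr0 addr0.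
  have {ij}? : i = j by rewrite -ij subrK.
  subst j; rewrite -bw; exists (- phi (a *: z - b)).
    by apply: rpredNr; apply: bE.
  by exists (phi z); rewrite linearB linearZ opprB /= -[a *: _]/(a * _) subrK.
move=> /(ideal_mult_add_principal (@projP (i - 1)) iq)[y [u [qy wE]]].
exists s => //; exists (diff P (i - 1) i u); first exact: coboundary_diff.
(* Apply d to s w - v = y + a u. The factor a can afterwards be cancelled because q is prime and a
   lies outside q. *)
have : ideal_mult (fun r => r \in q) (a *: (s *: z - diff P (i - 1) i u)).
  have -> : a *: (s *: z - diff P (i - 1) i u)
      = s *: (a *: z - b) + diff P (i - 1) i y.
    have vi : diff P (i - 1) i v = 0 by case: cv => k [x ->]; rewrite diff_diff.
    have := congr1 (diff P (i - 1) i) wE.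
    rewrite linearB linearD !linearZ /= vi subr0 -bw => E.
    by rewrite !scalerBr E opprD addrA [RHS]addrAC subrK !scalerA mulrC.
  apply: ideal_multD => //; first exact: ideal_multZ.
  exact: ideal_mult_linear.
move=> qE phi; have := qE phi; rewrite linearZ /=.
by rewrite prime_idealrM (negPf qa).
Qed.

Hypothesis noethR : noetherian R.
(** The first alternative will serve q = m: such an s annihilates P/qP. *)
Hypothesis gen : forall q : prime_idealr R,
  (exists2 s, s \in q & s \notin p) \/ generically_exact q P.

Lemma locally_exact_ideal J : ideal_set J -> locally_exact J.
Proof.
apply: (noetherian_induction noethR) => {}J iJ IH; have [J0 JD JM] := iJ.
have exD a : ~ J a -> locally_exact (add_principal J a).
  move=> Ja; apply: IH; first exact: ideal_set_add_principal.
    by move=> r Jr; exists r => //; exists 0; rewrite mulr0 addr0.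
  by exists a => //; exists 0 => //; exists 1; rewrite mulr1 add0r.
case: (pselect (J 1)) => [J1|J1].
  move=> i z _; exists 1; first by rewrite idealr1.
  exists 0; first exact: coboundary0.
  by move=> phi; rewrite -[phi _]mulr1; apply: JM.
case: (pselect (forall a b, J (a * b) -> J a \/ J b)) => [Jp|/existsNP[a /existsNP[b]]].
  have [q qE] := prime_of_set iJ J1 Jp.
  have {qE}? : J = fun r => r \in q by apply/funext => r; apply/propext; rewrite qE.
  subst J; have [[s qs ps]|exq] := gen q.
    move=> i z _; exists s => //; exists 0; first exact: coboundary0.
    by move=> phi; rewrite subr0 linearZ /= -[_ *: _]/(_ * _) mulrC; apply: idealMr.
  by apply: locally_exact_prime => // a /negP; apply: exD.
move=> /not_implyP[Jab /not_orP[Ja Jb]].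
apply: (locally_exact_colon iJ (exD a Ja)); apply: IH.
- exact: ideal_set_colon.
- by move=> r Jr; apply: JM.
- by exists b.
Qed.

Lemma locally_exact_cocycle i (z : P i) : cocycle z ->
  exists2 s, s \notin p & coboundary (s *: z).
Proof.
move=> cz; have [|s ps [b cb /(ideal_mult_eq0 (@projP i))]] :=
    locally_exact_ideal (ideal_set_eq0 R) (i := i) (z := z).
  by move=> j phi; rewrite cz linear0.
by move/eqP; rewrite subr_eq0 => /eqP E; exists s; rewrite ?E.
Qed.

End LocalExactness.

(** * From small support to torsion in cohomology *)

Section SupportAtMaximalIdeal.
Variables (R : comNzRingType) (m : idealr R) (Y : complex R).
Hypothesis noethR : noetherian R.
Hypothesis locR : local_ring m.

Lemma prime_neq_max (q : prime_idealr R) : ~ q =i m ->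
  exists2 s, s \in m & s \notin q.
Proof.
move=> qm; apply: contrapT => no; apply: qm => r; apply/idP/idP; first exact: locR.
by move=> mr; apply: contrapT => /negP qr; apply: no; exists r.
Qed.

Hypothesis suppY : forall q : prime_idealr R, small_supp Y q -> q =i m.

(** A prime q outside the small support comes with a resolution depending on q; homotopy equivalence
    transfers generic exactness to one fixed resolution P. *)
Lemma supp_cocycle_torsion (p : prime_idealr R) i (z : Y i) : ~ p =i m ->
  cocycle z -> exists2 s, s \notin p & coboundary (s *: z).
Proof.
move=> pm cz.
have res (q : prime_idealr R) : ~ q =i m -> exists Q : semi_projective_resolution Y,
    acyclic (Ltensor Q (residue_field q)).
  move=> qm; apply: contrapT => no; apply/qm/suppY => Q aQ.
  by apply: no; exists Q.
(* That p lies outside the support also supplies a resolution to work with. *)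
have [P _] := res p pm.
have [/quasi_isoP qP [projP _]] := (proj_res_quasi_iso P, proj_res_semi_projective P).
have [z' cz' bz'] := (qP i).2 z cz.
have [|s ps sz'] := locally_exact_cocycle (p := p) projP noethR _ cz'.
  move=> q; case: (pselect (q =i m)) => [qm|qm].
    by left; have [s ms ps] := prime_neq_max pm; exists s; rewrite ?qm.
  right; have [Q aQ] := res q qm.
  have [f [g [h hE]]] := semi_projective_comparison P Q.
  apply: (generically_exact_homotopy hE).
  apply: acyclic_tensor_generically_exact aQ.
  by have [] := proj_res_semi_projective Q.
exists s => //.
have -> : s *: z = proj_res_map P i (s *: z')
    - s *: (proj_res_map P i z' - z).
  by rewrite linearZ /= scalerBr opprB addrC subrK.
apply: coboundaryD; last exact/coboundaryN/coboundaryZ.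
by case: sz' => j [w ->]; rewrite cmap_diff; apply: coboundary_diff.
Qed.

End SupportAtMaximalIdeal.

Lemma trunc_le_cocycle_torsion (R : comNzRingType) (m : idealr R) (X : complex R) n :
  noetherian R -> local_ring m ->
  (forall q : prime_idealr R, small_supp (trunc_le n X) q -> q =i m) ->
  forall (p : prime_idealr R) i (z : X i), i <= n -> ~ p =i m -> cocycle z ->
  exists2 s, s \notin p & coboundary (s *: z).
Proof.
move=> noethR locR suppX p i z ile pm cz.
have zS : z \in @trunc_le_pred R n X i.
  by apply/asboolP; split=> [ni|_]; [move: ile; rewrite leNgt ni | apply: cz].
have [|s ps [j [w /(congr1 val) sw]]] := @supp_cocycle_torsion _ _ _ noethR locR suppX
  p i (Subm zS : trunc_le n X i) pm.
  by move=> j; apply: val_inj => /=; rewrite cz.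
by exists s => //; exists j, (val w).
Qed.

(** * Injective hulls *)

Section InjectiveHulls.
Variable R : comNzRingType.

Lemma linear_inverse (U V : lmodType R) (f : {linear U -> V}) :
  injective f -> (forall y, exists x, f x = y) ->
  exists g : {linear V -> U}, cancel f g /\ cancel g f.
Proof.
move=> fi fs; have [g gK] := choice fs.
have gL : linear g by move=> a x y; apply: fi; rewrite linearP !gK.
by exists (lin_of gL); split=> // x; apply: fi; rewrite /= gK.
Qed.

Lemma linear_inj (U V : lmodType R) (f : {linear U -> V}) :
  (forall x, f x = 0 -> x = 0) -> injective f.
Proof.
move=> f0 x y xy; apply/eqP; rewrite -subr_eq0; apply/eqP/f0.
by rewrite linearB xy subrr.
Qed.

(** A nonzero kernel of g would meet the image of f. *)
Lemma essential_inj (M E F : lmodType R) (f : {linear M -> E}) (g : {linear E -> F}) :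
  essential f -> (forall x, g (f x) = 0 -> f x = 0) -> injective g.
Proof.
move=> ess gf; apply: linear_inj => y gy; apply: contrapT => /eqP y0.
have [|x /eqP gfx /eqP] := ess (ker_pred g).
  by exists y => //; apply/eqP.
by apply; apply: gf.
Qed.

(** Extend f' psi to g; it is injective by essentiality, so it has a retraction r as E is injective.
    Essentiality of f' makes r injective too, whence g r = id. *)
Lemma injective_hull_unique (M M' E E' : lmodType R) (psi : {linear M -> M'}) :
  injective psi -> (forall y, exists x, psi x = y) ->
  injective_hull M E -> injective_hull M' E' ->
  exists (g : {linear E -> E'}) (r : {linear E' -> E}), cancel g r /\ cancel r g.
Proof.
move=> psi_i psi_s [injE [f [f_i f_ess]]] [injE' [f' [f'_i f'_ess]]].
pose f'psi := lin_of (linearP (f' \o psi)).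
have [g gE] := injE' _ _ f f'psi f_i.
have g_i : injective g.
  apply: (essential_inj f_ess) => x; rewrite gE /= -(linear0 f') => /f'_i.
  by rewrite -(linear0 psi) => /psi_i ->; rewrite linear0.
have [r rE] := injE _ _ g (id_map E) g_i.
have r_i : injective r.
  apply: (essential_inj f'_ess) => y; have [x <-] := psi_s y.
  rewrite -[f' _]/(f'psi x) -gE rE /= -(linear0 f) => /f_i ->.
  by rewrite !linear0.
by exists g, r; split=> // y; apply: r_i; rewrite rE.
Qed.

Definition multiples (V : lmodType R) (e : V) : {pred V} :=
  fun y => `[< exists r, y = r *: e >].

Fact multiples_closed (V : lmodType R) (e : V) : subsemimod_closed (multiples e).
Proof.
split; first split.
- by apply/asboolP; exists 0; rewrite scale0r.
- move=> _ _ /asboolP[r ->] /asboolP[s ->]; apply/asboolP.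
  by exists (r + s); rewrite scalerDl.
- by move=> a _ /asboolP[r ->]; apply/asboolP; exists (a * r); rewrite scalerA.
Qed.
HB.instance Definition _ (V : lmodType R) (e : V) :=
  GRing.isSubmodClosed.Build R V (multiples e) (multiples_closed e).

(** If e were nonzero, Re would meet R/p in a nonzero element, again killed by s; but s is a
    nonzerodivisor on the domain R/p. *)
Lemma hull_prime_torsionfree (p : prime_idealr R) (E : lmodType R) s (e : E) :
  injective_hull (cyclic_mod p) E -> s \notin p -> s *: e = 0 -> e = 0.
Proof.
move=> [_ [f [f_i ess]]] ps se; apply: contrapT => /eqP e0.
have [|x /asboolP[r fxE] /eqP] := ess (multiples e).
  by exists e => //; apply/asboolP; exists 1; rewrite scale1r.
apply; have : f (s *: x) = 0 by rewrite linearZ /= fxE scalerA mulrC -scalerA se scaler0.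
rewrite -(linear0 f) => /f_i.
rewrite -(cls_repr x) [s *: _]qscale_cls -(cls0 (ideal_pred p)) => /cls_eqP.
rewrite subr0 => /[!prime_idealrM] /orP[|px]; first by rewrite (negPf ps).
by congr (f _); apply/cls_eqP; rewrite subr0.
Qed.

Section DirectSums.
Variables (T : Type) (A : T -> Prop) (M : T -> lmodType R) (D : lmodType R).
Variable iota : forall t, {linear M t -> D}.
Hypothesis dsD : direct_sum A iota.

Let summand (u : {t & M t}) : D := iota (tag u) (tagged u).

(** Independence in [direct_sum] concerns distinct indices only, so terms with a repeated index are
    merged first. *)
Lemma direct_sum_repr (x : D) : exists n (u : 'I_n -> {t & M t}),
  [/\ injective (fun i => tag (u i)), forall i, A (tag (u i)) &
      x = \sum_(i < n) summand (u i)].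
Proof.
have [n [t [y [At ->]]]] := dsD.1 x.
elim: n t y At => [|n IH] t y At.
  exists 0%N, (fun i => Tagged (fun t => M t) (y i)).
  by split; rewrite ?big_ord0 //; case.
rewrite big_ord_recl.
have [k [u [ui Au ->]]] := IH _ (fun i => y (lift ord0 i)) (fun i => At (lift ord0 i)).
move: (t ord0) (y ord0) (At ord0) => t0 y0 At0 {t y At IH}.
have [[j uj]|uj] := pselect (exists j, tag (u j) = t0).
  subst t0; exists k, (fun i => if i == j then Tagged (fun t => M t) (y0 + tagged (u j))
                        else u i).
  split=> [i i'|i|].
  - by do 2!case: eqP => [->|_] //=; apply: ui.
  - by case: eqP.
  rewrite [RHS](bigD1 j) //= eqxx /summand /= linearD -addrA; congr (_ + _).
  by rewrite (bigD1 j) //=; congr (_ + _); apply: eq_bigr => i /negPf ->.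
exists k.+1, (fun i => if unlift ord0 i is Some j then u j
                       else Tagged (fun t => M t) y0).
split=> [i i'|i|].
- case: unliftP => [j ->|->]; case: unliftP => [j' ->|->] //=.
  + by move=> /ui ->.
  + by move=> E; case: uj; exists j.
  + by move=> E; case: uj; exists j'.
- by case: unliftP.
rewrite big_ord_recl unlift_none; congr (_ + _).
by apply: eq_bigr => i _; rewrite liftK.
Qed.

(** By independence, an s killing x kills all its components; the s chosen for t thus forces the
    component at t to vanish. *)
Lemma direct_sum_torsion (x : D) :
  (forall t, A t -> exists2 s, s *: x = 0 & forall e : M t, s *: e = 0 -> e = 0) ->
  x = 0.
Proof.
have [n [u [ui Au ->]]] := direct_sum_repr x => tors.
rewrite big1 // => i _; have [s sx s_i] := tors _ (Au i).
suff tag0 : tagged (u i) = 0 by rewrite /summand tag0 linear0.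
apply: s_i.
apply: (dsD.2 n (fun i => tag (u i)) (fun i => s *: tagged (u i))) => //.
rewrite -[RHS]sx scaler_sumr; apply: eq_bigr => j _.
by rewrite linearZ.
Qed.

Lemma direct_sum_inj t : A t -> injective (iota t).
Proof.
move=> At; apply: linear_inj => y ty.
apply: (dsD.2 1%N (fun=> t) (fun=> y) _ _ _ ord0) => //.
  by move=> i j _; rewrite !ord1.
by rewrite big_ord1.
Qed.

Lemma direct_sum_single t : A t -> (forall t', A t' -> t' = t) ->
  forall x, exists y, iota t y = x.
Proof.
move=> At Au x; have [n [t' [y [At' ->]]]] := dsD.1 x.
elim/big_ind: _ => [|_ _ [u <-] [v <-]|i _].
- by exists 0; rewrite linear0.
- by exists (u + v); rewrite linearD.
- move: (t' i) (y i) (At' i) => t0 y0 /Au ?; subst t0.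
  by exists y0.
Qed.

End DirectSums.

(** The summands of I are indexed by primes, so primes with the same elements must be equal as
    indices. *)
Lemma prime_idealr_eq (p q : prime_idealr R) : p =i q -> p = q.
Proof.
case: p q => [p cp] [q cq] pq.
have {}pq : p = q by apply/funext => r; exact: pq.
subst q; congr PrimeIdealr.Pack.
case: cp cq => [[a1] [a2] [a3] [a4]] [[b1] [b2] [b3] [b4]].
by congr PrimeIdealr.Class; congr (_ _); apply: Prop_irrelevance.
Qed.

Section LocalRing.
Variables (m : idealr R) (locR : local_ring m).

(** For a outside m, the ideal m + (a) cannot be proper. With a, b outside m and a b in m,
    multiplying the two expressions of 1 would put 1 into m. *)
Lemma local_prime : exists p : prime_idealr R, p =i m.
Proof.
have im := ideal_set_idealr m; have [_ mD mM] := im.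
have unit a : a \notin m -> exists2 x, x \in m & exists c, 1 = x + a * c.
  move=> ma; apply: contrapT => no.
  have [|J JP] := idealr_of_set (ideal_set_add_principal a im).
    by move=> [x mx [c E]]; apply: no; exists x => //; exists c.
  move/negP: ma; apply; apply/locR/JP; exists 0; first exact: idealr0.
  by exists 1; rewrite mulr1 add0r.
have [|a b mab|p pE] := @prime_of_set _ (fun r => r \in m) im.
- by rewrite idealr1.
- case: (boolP (a \in m)) => [|/unit[x mx [c ac]]]; first by left.
  case: (boolP (b \in m)) => [|/unit[y my [e be]]]; first by right.
  have : 1 \in m; last by rewrite idealr1.
  rewrite -[1]mulr1 {1}ac be.
  have -> : (x + a * c) * (y + b * e) = (y + b * e) * x + a * c * y + (c * e) * (a * b).
    by ring.
  by apply: (mD); [apply: (mD)|]; apply: (mM).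
- by exists p => r; apply/idP/idP => /pE.
Qed.

(** For p other than m, the chain from p to m has length one; no chain ascends from m, which
    contains every proper ideal. *)
Lemma quotient_dim0 (p : prime_idealr R) : quotient_dim p 0 <-> p =i m.
Proof.
have [pm pmE] := local_prime.
split=> [[_ dim0]|pm'].
  apply: contrapT => npm; have [s ms ps] := prime_neq_max locR npm.
  suff : (1 <= 0)%N by [].
  apply: (dim0 1%N (fun n => if n is 0%N then p else pm)); split=> [[|i] _ r|[|i] //= _].
  - by [].
  - by rewrite pmE; apply: locR.
  - split=> [r|sub]; first by rewrite pmE; apply: locR.
    by move/negP: ps; apply; apply: sub; rewrite pmE.
split; first by exists (fun=> p); split=> // i _ r.
move=> [|k] // c [cV cS]; have [_ []] := cS 0%N isT.
move=> r /locR; rewrite -pm'; apply: cV; exact: leq0n.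
Qed.

Lemma quotient_dim_unique (I : idealr R) n k :
  quotient_dim I n -> quotient_dim I k -> n = k.
Proof.
move=> [[c cc] ub] [[c' cc'] ub']; apply/eqP; rewrite eqn_leq.
by rewrite (ub' _ c) // (ub _ c').
Qed.

End LocalRing.

End InjectiveHulls.

(** * The top component of the dualizing complex *)

Section TopComponent.
Variables (R : comNzRingType) (X I : complex R) (E : lmodType R) (d : nat).
Variables (eps : {linear E -> I d%:Z}) (rho : {linear I d%:Z -> E}).
Hypothesis epsK : cancel eps rho.
Hypothesis rhoK : cancel rho eps.
Hypothesis Itop : forall k (y : I k), d%:Z < k -> y = 0.

Lemma single_eq0 j (x : single E j) : 0 <> j -> x = 0.
Proof. by case: j x => [[|j]|j] x // _; apply: thinmx0. Qed.

Lemma single_injective j : injective_module E -> injective_module (single E j).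
Proof.
move=> injE; case: j => [[|j]|j] // A B i f fi; exists (zero_map _ _) => x;
  by rewrite [RHS]thinmx0.
Qed.

Lemma diff_hom_index (Y : complex R) k n n' (f : hom X Y k) i j x :
  k + 1 = n -> k + 1 = n' ->
  diff (homc X Y) k n f i j x = diff (homc X Y) k n' f i j x.
Proof. by move=> <- <-. Qed.

Definition top_hom n (f : hom X (single E) n) : hom X I (n + d%:Z).
Proof.
exists (fun i j x => eqmap I d%:Z j (eps (f i 0 x))) => [i j|i j x ij].
  by move=> a x y; rewrite !linearP.
have [dj|/eqP dj] := eqVneq d%:Z j; last by rewrite eqmap_neq.
by rewrite hfun_neq ?linear0 //; lia.
Defined.

Fact top_hom_linear n : linear (@top_hom n).
Proof. by move=> a f g; apply: homP => i j x /=; rewrite !linearP. Qed.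

(** Induced by E[-d] -> I. The sign (-1)^d of the shift turns (-1)^(m+d) into (-1)^m, and the
    differential leaving I^d is zero. *)
Definition top_map : chain_map (homc X (single E)) (shift (homc X I) d%:Z).
Proof.
exists (fun n => lin_of (@top_hom_linear n)) => m n f.
have [mn|/eqP mn] := eqVneq (m + 1) n; last by rewrite !diff_neq // linear0.
have mnd : m + d%:Z + 1 = n + d%:Z by lia.
apply: homP => i j x.
have -> : diff (shift (homc X I) d%:Z) m n (top_hom f) i j x
   = sgn R d%:Z *: diff (homc X I) (m + d%:Z) (n + d%:Z) (top_hom f) i j x by [].
rewrite (hom_diffE _ _ mnd (subrK 1 j) erefl).
have -> : diff I (j - 1) j (top_hom f i (j - 1) x) = 0.
  have [dj|dj] := ltP d%:Z j; first exact: Itop.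
  by rewrite /= eqmap_neq ?linear0 //; lia.
rewrite -[LHS]/(eqmap I d%:Z j (eps (diff (homc X (single E)) m n f i 0 x))).
rewrite (hom_diffE _ _ mn (addNr 1) erefl) !sub0r -scaleNr !linearZ /=.
by rewrite scalerA -sgnM -mulrA sgnMs mulr1 scalerN scaleNr.
Defined.

Lemma top_map_inj n (f : hom X (single E) n) : top_map n f = 0 -> f = 0.
Proof.
move=> f0; apply: homP => i j x.
have [j0|/eqP j0] := eqVneq 0 j; last by rewrite [LHS]single_eq0 // [RHS]single_eq0.
subst j; apply: (can_inj epsK); rewrite [RHS]linear0.
by have := congr1 (fun h : hom _ _ _ => h i d%:Z x) f0; rewrite /= eqmap_id.
Qed.

(** Since I is zero above d, only the components into I^d remain. *)
Lemma top_map_surj n (k : hom X I (n + d%:Z)) : vanish_below d%:Z k ->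
  exists g : hom X (single E) n, top_map n g = k.
Proof.
move=> kv; pose g i j (x : X i) := eqmap (single E) 0 j (rho (k i d%:Z x) : single E 0).
have gL i j : linear (@g i j) by move=> a x y; rewrite /g !linearP.
have gn i j x : i + n <> j -> @g i j x = 0.
  move=> ij; have [j0|/eqP j0] := eqVneq 0 j; last by rewrite /g eqmap_neq.
  by rewrite /g hfun_neq ?linear0 //; lia.
exists (Hom gL gn); apply: homP => i j x /=; rewrite /g eqmap_id rhoK.
case: (ltgtP d%:Z j) => [dj|jd|<-]; last by rewrite eqmap_id.
  by rewrite [LHS](Itop _ dj) [RHS](Itop _ dj).
by rewrite [RHS]kv // eqmap_neq //; lia.
Qed.

Variable a : int.
Hypothesis Ibot : forall k (y : I k), k < a -> y = 0.
Hypothesis Iinj : forall k, injective_module (I k).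
Hypothesis Ikill : forall i k, i <= -1 -> k < d%:Z ->
  forall g : {linear X i -> I k}, (forall j x, g (diff X j i x) = 0) ->
  forall x, cocycle x -> g x = 0.

(** Modulo coboundaries, [clear_below] moves a hom into the image of [top_map]. Injectivity clears a
    hom of degree n - 1 + d: a component X^i -> I^k with k < d then has i < 1 - n, hence i <= -1
    exactly because n > 0. *)
Lemma top_map_iso n : 0 < n -> cohomology_iso_at top_map n.
Proof.
move=> n_gt0; split=> [f _ /(@coboundaryP _ _ _ _ (n - 1) (subrK 1 n))[h hE]|y cy].
  have nd : n - 1 + d%:Z + 1 = n + d%:Z by lia.
  have [||||h' hv] := @clear_below _ X I (n - 1 + d%:Z) d%:Z _ _ a h.
  - by [].
  - by move=> i k ik kd; apply: Ikill => //; lia.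
  - exact: Ibot.
  (* The differential of h is, up to sign, a hom coming from E, so it has no components below d. *)
  - move=> i j x jd; rewrite (diff_hom_index _ _ _ erefl nd).
    have := congr1 (fun h : hom _ _ _ => h i j x) hE.
    rewrite [LHS]/= eqmap_neq; last by lia.
    move=> /esym /(congr1 ( *:%R (sgn R d%:Z))).
    rewrite scaler0 /= scalerA sgnMs scale1r; exact.
  have [g gE] := top_map_surj hv; exists (n - 1), g.
  apply/eqP; rewrite -subr_eq0; apply/eqP; apply: top_map_inj.
  rewrite linearB cmap_diff gE linearB.
  have -> : diff (shift (homc X I) d%:Z) (n - 1) n
      (diff (homc X I) (n - 1 + d%:Z - 1) (n - 1 + d%:Z) h') = 0.
    set dh' := diff (homc X I) _ _ h'.
    have dd : diff (homc X I) (n - 1 + d%:Z) (n + d%:Z) dh' = 0 by apply: diff_diff.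
    by rewrite -[LHS]/(sgn R d%:Z *: diff (homc X I) (n - 1 + d%:Z) (n + d%:Z) dh')
      dd scaler0.
  by rewrite subr0 hE subrr.
have dy : diff (homc X I) (n + d%:Z) (n + 1 + d%:Z) y = 0.
  have := cy (n + 1); move=> /(congr1 ( *:%R (sgn R d%:Z))).
  by rewrite scaler0 /= scalerA sgnMs scale1r.
have nd : n + d%:Z + 1 = n + 1 + d%:Z by lia.
have [||||h hv] := @clear_below _ X I (n + d%:Z) d%:Z _ _ a y.
- by [].
- by move=> i k ik kd; apply: Ikill => //; lia.
- exact: Ibot.
- by move=> i j x jd; rewrite (diff_hom_index _ _ _ erefl nd) dy.
have [g gE] := top_map_surj hv; exists g.
  apply/cocycleP/top_map_inj; rewrite cmap_diff gE linearB.
  rewrite [X in X - _](cy (n + 1)) sub0r -[RHS]oppr0; congr (- _).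
  set dh := diff (homc X I) _ _ h.
  have dd : diff (homc X I) (n + d%:Z) (n + 1 + d%:Z) dh = 0 by apply: diff_diff.
  by rewrite -[LHS]/(sgn R d%:Z *: diff (homc X I) (n + d%:Z) (n + 1 + d%:Z) dh)
    dd scaler0.
rewrite gE addrC addKr; apply: coboundaryN.
(* The degree of h is rewritten as that of the shifted complex, and (-1)^d compensates the sign of
   its differential. *)
have e : n + d%:Z - 1 = n - 1 + d%:Z by lia.
move: h {hv gE}; rewrite e => h; exists (n - 1), (sgn R d%:Z *: h).
rewrite -[RHS]/(sgn R d%:Z *:
  diff (homc X I) (n - 1 + d%:Z) (n + d%:Z) (sgn R d%:Z *: h)).
by rewrite [X in _ *: X]linearZ scalerA sgnMs scale1r.
Qed.

End TopComponent.

(** * Truncations *)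

Section Truncations.
Variable R : comNzRingType.
Implicit Types C D : complex R.

Lemma quasi_iso_bijective C D (f : chain_map C D) :
  (forall n, injective (f n)) -> (forall n y, exists x, f n x = y) -> quasi_iso f.
Proof.
move=> fi fs; apply/quasi_isoP => n; split=> [x _ [j [y]]|y cy].
  have [w <-] := fs j y; rewrite -cmap_diff => /fi ->; exact: coboundary_diff.
have [x xy] := fs n y; exists x; last by rewrite xy subrr; apply: coboundary0.
by move=> j; apply: fi; rewrite cmap_diff xy cy linear0.
Qed.

Lemma quasi_iso_comp A B C (g : chain_map B C) (f : chain_map A B) :
  quasi_iso f -> quasi_iso g -> quasi_iso (comp_map (R := R) g f).
Proof.
move=> /quasi_isoP qf /quasi_isoP qg; apply/quasi_isoP => n.
exact: cohomology_iso_at_comp.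
Qed.

Lemma eqmapK (F : int -> lmodType R) i j x :
  i = j -> eqmap F j i (eqmap F i j x) = x.
Proof. by move=> ij; subst j; rewrite !eqmap_id. Qed.

Lemma trunc_gt_le C n i (p : trunc_gt n C i) : i <= n -> (val p).1 = 0.
Proof. by have /asboolP[] := valP p. Qed.

Lemma trunc_gt_snd C n i (p : trunc_gt n C i) : i <> n -> (val p).2 = 0.
Proof. by have /asboolP[_] := valP p => + /eqP/negPf ni; rewrite ni. Qed.

(** The only component that survives is Im d^n, and it is included into the next one. *)
Lemma trunc_gt_cocycle0 C n i (p : trunc_gt n C i) : i <= n -> cocycle p -> p = 0.
Proof.
move=> ni cp; apply: val_inj; rewrite [val p]surjective_pairing trunc_gt_le //.
congr pair; have := congr1 (fun q => (val q).1) (cp (i + 1)).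
by rewrite /= trunc_gt_le // linear0 add0r eqmap_id.
Qed.

Lemma trunc_gt_cocycle_fst C n i (p : trunc_gt n C i) :
  n < i -> cocycle p -> cocycle (val p).1.
Proof.
move=> ni cp j; have := congr1 (fun q => (val q).1) (cp j).
by rewrite /= trunc_gt_snd ?linear0 ?addr0 //; lia.
Qed.

(** In degree n + 1 the coboundaries come from the summand Im d^n, which is the module of
    coboundaries of C. *)
Lemma trunc_gt_coboundary C n i (p : trunc_gt n C i) :
  n < i -> coboundary p <-> coboundary (val p).1.
Proof.
move=> ni; split=> [|bp].
  move=> /coboundary_pred_diff[q ->] /=.
  apply: coboundaryD; first exact: coboundary_diff.
  have [iE|/eqP iE] := eqVneq (i - 1) n; last first.
    by rewrite trunc_gt_snd // linear0; apply: coboundary0.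
  have /asboolP[_] := valP q; case: eqP => // _ [x ->].
  by rewrite eqmap_diff ?subrK //; apply: coboundary_diff.
have [k ki] : exists k, k + 1 = i by exists (i - 1); rewrite subrK.
subst i; have [x pE] := coboundaryP (erefl (k + 1)) bp; exists k.
have pair_eq : val p = ((val p).1, 0).
  by rewrite {1}[val p]surjective_pairing trunc_gt_snd //; lia.
have [kn|/eqP kn] := eqVneq k n.
  have qS : (0, diff C k (k + 1) x) \in @trunc_gt_pred R n C k.
    by apply/asboolP; split=> //=; case: eqP => // _; exists x.
  exists (Subm qS); apply: val_inj; rewrite pair_eq; congr pair => /=.
  by rewrite linear0 add0r eqmap_id.
have qS : (x, 0) \in @trunc_gt_pred R n C k.
  by apply/asboolP; split=> /= [|]; [lia | case: eqP].
exists (Subm qS); apply: val_inj; rewrite pair_eq; congr pair => /=.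
by rewrite linear0 addr0.
Qed.

Section TruncMap.
Variables (C D : complex R) (f : chain_map C D) (n : int).

Fact trunc_gt_map_subproof i (p : trunc_gt n C i) :
  (f i (val p).1, f (i + 1) (val p).2) \in @trunc_gt_pred R n D i.
Proof.
have /asboolP[p1 p2] := valP p; apply/asboolP; split=> [ni|] /=.
  by rewrite p1 // linear0.
case: eqP p2 => [_ [x ->]|_ ->]; last by rewrite linear0.
by exists (f i x); rewrite cmap_diff.
Qed.

Definition trunc_gt_map_fun i (p : trunc_gt n C i) : trunc_gt n D i :=
  Subm (trunc_gt_map_subproof p).

Fact trunc_gt_map_linear i : linear (@trunc_gt_map_fun i).
Proof. by move=> a p q; apply: val_inj; congr pair; rewrite /= linearP. Qed.

Definition trunc_gt_map : chain_map (trunc_gt n C) (trunc_gt n D).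
Proof.
exists (fun i => lin_of (@trunc_gt_map_linear i)) => i j p.
apply: val_inj; congr pair; rewrite /= ?linear0 // linearD cmap_diff.
congr (_ + _); have [ij|/eqP ij] := eqVneq (i + 1) j.
  by subst j; rewrite !eqmap_id.
by rewrite !eqmap_neq // linear0.
Defined.

Lemma trunc_gt_quasi_iso :
  (forall i, n < i -> cohomology_iso_at f i) -> quasi_iso trunc_gt_map.
Proof.
move=> qf; apply/quasi_isoP => i; have [ni|ni] := lerP i n.
  split=> [p cp _|q cq].
    by rewrite (trunc_gt_cocycle0 ni cp); apply: coboundary0.
  exists 0; first by move=> j; rewrite linear0.
  by rewrite (trunc_gt_cocycle0 ni cq) linear0 subrr; apply: coboundary0.
have [fi fs] := qf i ni; split=> [p cp|q cq].
  rewrite !trunc_gt_coboundary //=; apply: fi; exact: trunc_gt_cocycle_fst.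
have [x cx bx] := fs _ (trunc_gt_cocycle_fst ni cq).
have pS : (x, 0) \in @trunc_gt_pred R n C i.
  by apply/asboolP; split=> /= [|]; [lia | case: eqP => //; lia].
exists (Subm pS : trunc_gt n C i); last by rewrite trunc_gt_coboundary.
by move=> j; apply: val_inj; congr pair; rewrite /= cx linear0 addr0.
Qed.

End TruncMap.

Section TruncShift.
Variables (D : complex R) (k : int).

(** In the shift of the truncation the inclusion of Im d^k also acquires the sign (-1)^k; the factor
    on the second coordinate accounts for it. *)
Definition trunc_gt_shift_pair i (p : trunc_gt 0 (shift D k) i) :
    D (i + k) * D (i + k + 1) :=
  ((val p).1, sgn R k *: eqmap D (i + 1 + k) (i + k + 1) (val p).2).

Fact trunc_gt_shift_subproof i (p : trunc_gt 0 (shift D k) i) :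
  trunc_gt_shift_pair p \in @trunc_gt_pred R k D (i + k).
Proof.
have /asboolP[p1 p2] := valP p; apply/asboolP; split=> [ik|] /=.
  by rewrite p1 //; lia.
case: eqP => ik; move: p2; case: eqP => i0; try lia; last first.
  by move=> ->; rewrite linear0 scaler0.
move=> [x ->]; exists x; rewrite /= linearZ /= scalerA sgnMs scale1r.
by rewrite eqmap_diff //; lia.
Qed.

Definition trunc_gt_shift_fun i (p : trunc_gt 0 (shift D k) i) :
    shift (trunc_gt k D) k i :=
  Subm (trunc_gt_shift_subproof p).

Fact trunc_gt_shift_linear i : linear (@trunc_gt_shift_fun i).
Proof.
move=> a p q; apply: val_inj; congr pair => //=.
by rewrite linearP scalerDr !scalerA mulrC.
Qed.

Definition trunc_gt_shift : chain_map (trunc_gt 0 (shift D k)) (shift (trunc_gt k D) k).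
Proof.
exists (fun i => lin_of (@trunc_gt_shift_linear i)) => i j p.
apply: val_inj; congr pair; rewrite /= ?linear0 ?scaler0 //.
rewrite scalerDr; congr (_ + _); rewrite linearZ scalerA sgnMs scale1r.
have [ij|/eqP ij] := eqVneq (i + 1) j; last first.
  rewrite (eqmap_neq _ ij) [RHS]eqmap_neq //; lia.
subst j; rewrite eqmap_id; have e : i + k + 1 = i + 1 + k by lia.
by rewrite e !eqmap_id.
Defined.

Lemma trunc_gt_shift_quasi_iso : quasi_iso trunc_gt_shift.
Proof.
apply: quasi_iso_bijective => i.
  apply: linear_inj => p p0; apply: val_inj.
  have := congr1 (fun q => (val q).1) p0; have := congr1 (fun q => (val q).2) p0.
  rewrite /= => p2 p1; rewrite [val p]surjective_pairing p1; congr pair.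
  have e : i + 1 + k = i + k + 1 by lia.
  move: p2 => /(congr1 ( *:%R (sgn R k))); rewrite scalerA sgnMs scale1r scaler0.
  by move: (val p).2 => /=; rewrite e => w; rewrite eqmap_id.
move=> q; have e : i + k + 1 = i + 1 + k by lia.
have /asboolP[q1 q2] := valP q.
have pS : ((val q).1, sgn R k *: eqmap D (i + k + 1) (i + 1 + k) (val q).2)
    \in @trunc_gt_pred R 0 (shift D k) i.
  apply/asboolP; split=> [ik|] /=; first by rewrite q1 //; lia.
  case: eqP => i0; move: q2; case: eqP => ik; try lia; last first.
    by move=> ->; rewrite linear0 scaler0.
  by move=> [x ->]; exists x; rewrite eqmap_diff.
exists (Subm pS); apply: val_inj; rewrite [RHS]surjective_pairing; congr pair => /=.
rewrite linearZ /= scalerA sgnMs scale1r.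
by rewrite eqmapK.
Qed.

End TruncShift.

Definition shift_map C D (f : chain_map C D) k : chain_map (shift C k) (shift D k).
Proof.
exists (fun i => f (i + k)) => i j x.
by rewrite /= linearZ /= cmap_diff.
Defined.

(** The differential changes only by the unit (-1)^k, which affects neither cocycles nor
    coboundaries. *)
Lemma cohomology_iso_at_shift C D (f : chain_map C D) k n :
  cohomology_iso_at f (n + k) -> cohomology_iso_at (shift_map f k) n.
Proof.
have cS B i (x : shift B k i) :
    @cocycle R (shift B k) i x <-> @cocycle R B (i + k) x.
  split=> [cx j|cx j]; last by rewrite /= cx scaler0.
  have e : j = j - k + k by rewrite subrK.
  have := congr1 (fun u => sgn R k *: u) (cx (j - k)).
  by rewrite /= scalerA sgnMs scale1r scaler0 -e.
have bS B i (x : shift B k i) :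
    @coboundary R (shift B k) i x <-> @coboundary R B (i + k) x.
  split=> [[j [y ->]]|[j]]; first exact/coboundaryZ/coboundary_diff.
  have -> : j = j - k + k by rewrite subrK.
  move=> [y ->]; exists (j - k), (sgn R k *: y).
  by rewrite /= linearZ /= scalerA sgnMs scale1r.
move=> [fi fs]; split=> [x /cS cx /bS bx|y /cS /fs[x cx bx]].
  exact/bS/fi.
by exists x; [apply/cS | apply/bS].
Qed.

End Truncations.

(** E is a hull of R/m for m an ideal, whereas the summands of I belong to primes; this passes from
    one to the other. *)
Lemma cyclic_mod_iso (R : comNzRingType) (I J : idealr R) : I =i J ->
  exists f : {linear cyclic_mod I -> cyclic_mod J},
    injective f /\ forall y, exists x, f x = y.
Proof.
move=> IJ; have clsL : linear (cls (ideal_pred J) : R^o -> cyclic_mod J).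
  by move=> a x y; rewrite clsD -qscale_cls.
have [|f fE] := @quot_lift R R^o (cyclic_mod J) (ideal_pred I) (lin_of clsL).
  move=> x; rewrite unfold_in /= => Ix; rewrite -[RHS](cls0 (ideal_pred J)).
  by apply/cls_eqP; rewrite subr0 unfold_in -IJ.
exists f; split=> [|y]; last by exists (cls _ (repr y)); rewrite fE /= cls_repr.
apply: linear_inj => x; rewrite -(cls_repr x) fE /= -(cls0 (ideal_pred J)).
move=> /cls_eqP; rewrite subr0 unfold_in -IJ => Ix.
by rewrite -[RHS](cls0 (ideal_pred I)); apply/cls_eqP; rewrite subr0.
Qed.

(** * Components of a normalized dualizing complex *)

Section NormalizedDualizingComplex.
Variables (R : comNzRingType) (m : idealr R) (d : nat) (I : complex R).
Hypothesis locR : local_ring m.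
Hypothesis normI : normalized d I.

Lemma normalized_top k (y : I k) : d%:Z < k -> y = 0.
Proof.
move=> dk; have [M [iota [_ [gen _]]]] := normI k.
have [[|n] [t [z [At ->]]]] := gen y; first by rewrite big_ord0.
by have [e [eE _]] := At ord0; lia.
Qed.

(** Only m has dim R/p = 0, so I^d is a single hull of the residue field. *)
Lemma normalized_top_hull (E : lmodType R) : injective_hull (cyclic_mod m) E ->
  exists (eps : {linear E -> I d%:Z}) (rho : {linear I d%:Z -> E}),
    cancel eps rho /\ cancel rho eps.
Proof.
move=> hullE; have [pm pmE] := local_prime locR.
have [M [iota [hullM dsM]]] := normI d%:Z.
have Apm : exists n : nat, n%:Z = d%:Z - d%:Z /\ quotient_dim pm n.
  by exists 0%N; rewrite subrr; split=> //; apply/(quotient_dim0 locR).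
have [psi [psi_i psi_s]] := @cyclic_mod_iso R m pm (fun r => esym (pmE r)).
have [g [r [gK rK]]] := injective_hull_unique psi_i psi_s hullE (hullM pm Apm).
have [|inv [invK Kinv]] := linear_inverse (direct_sum_inj dsM Apm).
  apply: (direct_sum_single dsM Apm) => p [n [n0 pn]]; apply: prime_idealr_eq => x.
  have e : n = 0%N by lia.
  by move: pn; rewrite e => /(quotient_dim0 locR) ->; rewrite pmE.
exists (lin_of (linearP (iota pm \o g))), (lin_of (linearP (r \o inv))).
by split=> x /=; rewrite ?invK ?gK ?rK ?Kinv.
Qed.

(** For k < d every summand E(R/p) of I^k has dim R/p > 0, so p is not m. *)
Lemma normalized_torsionfree k (y : I k) : k < d%:Z ->
  (forall p : prime_idealr R, ~ p =i m -> exists2 s, s \notin p & s *: y = 0) ->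
  y = 0.
Proof.
move=> kd tors; have [M [iota [hullM dsM]]] := normI k.
apply: (direct_sum_torsion dsM) => p [n [nk pn]].
have [|s ps sy] := tors p.
  move=> /(quotient_dim0 locR) /(quotient_dim_unique pn); lia.
exists s => // e; apply: hull_prime_torsionfree ps.
by apply: hullM; exists n.
Qed.

End NormalizedDualizingComplex.

(** * The isomorphism in D(R) *)

Theorem theorem3p1 (R : comNzRingType) (m : idealr R) (d : nat)
    (E : lmodType R) (I X : complex R)
    (JE : semi_injective_resolution (single E))
    (JI : semi_injective_resolution I) :
  noetherian R -> local_ring m -> krull_dim R d ->
  injective_hull (cyclic_mod m) E ->
  dualizing_complex I -> normalized d I ->
  (forall p : prime_idealr R, small_supp (trunc_le (-1) X) p -> p =i m) ->
  derived_iso (trunc_gt 0 (RHom X JE))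
              (shift (trunc_gt d%:Z (RHom X JI)) d%:Z).
Proof.
move=> noethR locR _ hullE [[a [b Iab]] injI _ _] normI suppX.
have [eps [rho [epsK rhoK]]] := normalized_top_hull locR normI hullE.
(* Both single E and I are bounded complexes of injectives, so Hom into them already computes
   RHom. *)
have post_qi (Y : complex R) (J : semi_injective_resolution Y) :
    k_injective Y -> quasi_iso (post_map X (inj_res_map J)).
  move=> kY; apply: k_injective_post_map (inj_res_quasi_iso J) => //.
  by have [] := inj_res_semi_injective J.
have kE : k_injective (single E).
  apply: (@bounded_injective_k_injective _ _ 0 0) => [k|k y k0].
    by apply: single_injective; have [] := hullE.
  by apply: single_eq0; lia.
have kI : k_injective I.
  by apply: (@bounded_injective_k_injective _ _ a b) => // k y /Iab; apply.
(* For each prime p other than m, some s outside p makes s z a coboundary, so s kills g z. *)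
have kill i k : i <= -1 -> k < d%:Z ->
    forall g : {linear X i -> I k}, (forall j x, g (diff X j i x) = 0) ->
    forall x, cocycle x -> g x = 0.
  move=> i1 kd g g0 z cz; apply: (normalized_torsionfree locR normI kd) => p pm.
  have [s ps [j [w sz]]] := trunc_le_cocycle_torsion noethR locR suppX i1 pm cz.
  by exists s => //; rewrite -[_ *: _]linearZ sz g0.
pose Itop := normalized_top normI.
have Ibot k (y : I k) : k < a -> y = 0 by move=> ka; apply: Iab; rewrite ka.
(* The apex of the roof is the truncation of Hom(X, E). One leg resolves E; the other joins
   [top_map], the resolution of I and the interchange of truncation and shift. *)
exists (trunc_gt 0 (homc X (single E))), (trunc_gt_map (post_map X (inj_res_map JE)) 0),
  (comp_map (trunc_gt_shift (homc X (inj_res JI)) d%:Z)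
    (trunc_gt_map (comp_map (shift_map (post_map X (inj_res_map JI)) d%:Z)
                            (top_map X eps Itop)) 0)).
split.
  by apply: trunc_gt_quasi_iso => i _; apply: (quasi_isoP _).1; apply: post_qi.
apply: quasi_iso_comp; last exact: trunc_gt_shift_quasi_iso.
apply: trunc_gt_quasi_iso => i i_gt0; apply: cohomology_iso_at_comp.
  exact: (top_map_iso epsK rhoK Itop Ibot injI kill i_gt0).
by apply: cohomology_iso_at_shift; apply: (quasi_isoP _).1; apply: post_qi.
Qed.
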